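(* Let $n\ge1$ be an integer, $\lambda>0$ with $\lambda\ne1$, let $\Psi=(V_1,V_2,\psi_1,\psi_2)^{\intercal}$ be the static rotationally invariant $n$-vortex with radial profiles $f_n,\beta_n$, and let $\mathcal H^+$ be its fluctuation operator (see context). The admissible eigenfunctions of $\mathcal H^+\xi=\omega^2\xi$ that satisfy the background gauge condition $$\partial_1a_1+\partial_2a_2-(\psi_1\varphi_2-\psi_2\varphi_1)=0$$ are characterized as follows (all radial functions are smooth on $r>0$). 1. (Derrick-type modes.) They have the form $$\xi=\big(\widetilde v(r)\sin\theta,\ -\widetilde v(r)\cos\theta,\ \widetilde u(r)\cos(n\theta),\ \widetilde u(r)\sin(n\theta)\big)^{\intercal},$$ where $\zeta=(\widetilde v,\widetilde u)^{\intercal}$ satisfies $\overline{\mathcal H}_0\zeta=\omega^2\zeta$ with $$\overline{\mathcal H}_0=\begin{pmatrix}-\frac{d^2}{dr^2}-\frac1r\frac{d}{dr}+\frac1{r^2}+f_n^2&\frac{2n}{r}(1-\beta_n)f_n\\[2pt]\frac{2n}{r}(1-\beta_n)f_n&-\frac{d^2}{dr^2}-\frac1r\frac{d}{dr}+\frac{n^2(1-\beta_n)^2}{r^2}+\frac{3\lambda}{2}f_n^2-\frac\lambda2\end{pmatrix}.$$ That is, a field of this form satisfies the background gauge condition and $\mathcal H^+\xi=\omega^2\xi$ if and only if $\overline{\mathcal H}_0\zeta=\omega^2\zeta$. 2. (Multipolar modes.) For each integer $\overline k\ge1$ they have the form $$\xi=\begin{pmatrix}\cos(\overline k\theta)\sin\theta\,[v'(r)-rf_n(r)w(r)]-\sin(\overline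 k\theta)\cos\theta\,\frac{\overline k v(r)}{r}\\-\cos(\overline k\theta)\cos\theta\,[v'(r)-rf_n(r)w(r)]-\sin(\overline k\theta)\sin\theta\,\frac{\overline kv(r)}{r}\\\cos(\overline k\theta)\cos(n\theta)u(r)+\overline k\sin(\overline k\theta)\sin(n\theta)w(r)\\\cos(\overline k\theta)\sin(n\theta)u(r)-\overline k\sin(\overline k\theta)\cos(n\theta)w(r)\end{pmatrix},$$ where $\zeta=(v,u,w)^{\intercal}$ satisfies $\overline{\mathcal H}_{\overline k}\,\zeta=\omega^2\zeta$ with $$\overline{\mathcal H}_{\overline k}=\begin{pmatrix}L+f_n^2&0&2(f_n+rf_n')\\[2pt]\frac{2n(1-\beta_n)f_n}{r}\frac{d}{dr}&L+\frac{n^2(1-\beta_n)^2}{r^2}+\frac{3\lambda}{2}f_n^2-\frac\lambda2&-\frac{2n(1-\beta_n)(\overline k^2+r^2f_n^2)}{r^2}\\[2pt]\frac{2f_n'}{r}&-\frac{2n(1-\beta_n)}{r^2}&L+\frac{n^2(1-\beta_n)^2}{r^2}+f_n^2+\frac\lambda2f_n^2-\frac\lambda2\end{pmatrix},\qquad L=-\frac{d^2}{dr^2}-\frac1r\frac{d}{dr}+\frac{\overline k^2}{r^2}.$$ That is, a field of the admissible angular form for $\overline k$ (see context) satisfies the background gauge condition and $\mathcal H^+\xi=\omega^2\xi$ if and only if it is of the displayed form with $\overline{\mathcal H}_{\overline k}\zeta=\omega^2\zeta$. Moreover, for $\overline k\ge1$, a second type of eigenfunction $\chi$, orthogonal to $\xi$,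 is obtained from the displayed form by the replacements $\cos(\overline k\theta)\to\sin(\overline k\theta)$, $\sin(\overline k\theta)\to-\cos(\overline k\theta)$, with $(v,u,w)$ satisfying the same reduced spectral problem $\overline{\mathcal H}_{\overline k}\zeta=\omega^2\zeta$. Therefore eigenvalues with $\overline k\ge1$ are doubly degenerate (each nonzero solution $\zeta$ gives the two linearly independent eigenfunctions $\xi$ and $\chi$ with the same $\omega^2$).
   Context: Polar coordinates $x_1=r\cos\theta$, $x_2=r\sin\theta$ on $\mathbb R^2$. The static rotationally invariant $n$-vortex of the Abelian-Higgs model with coupling $\lambda>0$ (self-dual when $\lambda=1$) is the real four-component field $$\Psi=(V_1,V_2,\psi_1,\psi_2)^{\intercal}=\Big(-\tfrac{n\beta_n(r)}{r}\sin\theta,\ \tfrac{n\beta_n(r)}{r}\cos\theta,\ f_n(r)\cos(n\theta),\ f_n(r)\sin(n\theta)\Big)^{\intercal},$$ where the profiles satisfy $$f_n''+\tfrac1r f_n'-\tfrac{n^2}{r^2}(1-\beta_n)^2f_n+\tfrac{\lambda}{2}(1-f_n^2)f_n=0,\qquad \beta_n''-\tfrac1r\beta_n'+f_n^2(1-\beta_n)=0,$$ $f_n(0)=\beta_n(0)=0$, $f_n(\infty)=\beta_n(\infty)=1$. Fluctuations are four-component real fields $\xi=(a_1,a_2,\varphi_1,\varphi_2)^{\intercal}$ on $\mathbb R^2$. With $\Delta=\partial_1^2+\partial_2^2$, $|\psi|^2=\psi_1^2+\psi_2^2$, summation over $k=1,2$ in $V_kV_k$ and $V_k\partial_k$, and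 $\widetilde D_i\psi_1=\partial_i\psi_1+V_i\psi_2$, $\widetilde D_i\psi_2=\partial_i\psi_2-V_i\psi_1$, the fluctuation operator is $$\mathcal H^+=\begin{pmatrix}-\Delta+|\psi|^2&0&-2\widetilde D_1\psi_2&2\widetilde D_1\psi_1\\0&-\Delta+|\psi|^2&-2\widetilde D_2\psi_2&2\widetilde D_2\psi_1\\-2\widetilde D_1\psi_2&-2\widetilde D_2\psi_2&-\Delta+\frac{3\lambda}{2}\psi_1^2+(1+\frac\lambda2)\psi_2^2-\frac\lambda2+V_kV_k&-2V_k\partial_k+(\lambda-1)\psi_1\psi_2\\2\widetilde D_1\psi_1&2\widetilde D_2\psi_1&2V_k\partial_k+(\lambda-1)\psi_1\psi_2&-\Delta+(1+\frac\lambda2)\psi_1^2+\frac{3\lambda}{2}\psi_2^2-\frac\lambda2+V_kV_k\end{pmatrix}.$$ Admissible angular form for $\overline k\ge1$: fields $$\begin{pmatrix} -g_1(r)\sin[(1-\overline k)\theta]-g_2(r)\sin[(1+\overline k)\theta]\\ g_1(r)\cos[(1-\overline k)\theta]+g_2(r)\cos[(1+\overline k)\theta]\\ t_1(r)\cos[(n-\overline k)\theta]+t_2(r)\cos[(n+\overline k)\theta]\\ t_1(r)\sin[(n-\overline k)\theta]+t_2(r)\sin[(n+\overline k)\theta]\end{pmatrix}$$ with radial functions $g_1,g_2,t_1,t_2$. For $\overline k=0$ the admissible (Derrick-type) form is $(-g(r)\sin\theta,\ g(r)\cos\theta,\ t(r)\cos n\theta,\ t(r)\sin n\theta)^{\intercal}$.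 Orthogonality is with respect to the inner product $\int_{\mathbb R^2}(a_1\tilde a_1+a_2\tilde a_2+\varphi_1\tilde\varphi_1+\varphi_2\tilde\varphi_2)\,d^2x$ (the angular integral vanishes). *)

(* Defs.v *)
From HB Require Import structures.
From mathcomp Require Import all_boot all_order all_algebra.
From mathcomp Require Import all_classical all_reals all_analysis.
Import Order.TTheory GRing.Theory Num.Theory.
Import numFieldNormedType.Exports.

Set Implicit Arguments.
Unset Strict Implicit.
Unset Printing Implicit Defensive.

Local Open Scope ring_scope.
Local Open Scope classical_set_scope.

Section Fields.
Variable R : realType.

(* A four-component real field; for the vortex background the components are
   (V_1, V_2, psi_1, psi_2), for a fluctuation (a_1, a_2, phi_1, phi_2).
   The two arguments are Cartesian coordinates, except where a [field] is used
   as the right-hand side of [polar_form], where they are (r, theta). *)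
Record field := Field {
  vec1 : R -> R -> R;
  vec2 : R -> R -> R;
  sca1 : R -> R -> R;
  sca2 : R -> R -> R
}.

Definition partial1 (h : R -> R -> R) (x y : R) : R := derive1 (fun s => h s y) x.
Definition partial2 (h : R -> R -> R) (x y : R) : R := derive1 (fun s => h x s) y.

Definition laplacian (h : R -> R -> R) (x y : R) : R :=
  partial1 (partial1 h) x y + partial2 (partial2 h) x y.

(* [F] is the expression of [xi] in polar coordinates, away from the origin. *)
Definition polar_form (xi F : field) : Prop :=
  forall r th : R, 0 < r ->
    [/\ vec1 xi (r * cos th) (r * sin th) = vec1 F r th,
        vec2 xi (r * cos th) (r * sin th) = vec2 F r th,
        sca1 xi (r * cos th) (r * sin th) = sca1 F r th
      & sca2 xi (r * cos th) (r * sin th) = sca2 F r th].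

Definition smooth_pos (h : R -> R) : Prop :=
  forall (m : nat) (r : R), 0 < r -> derivable (derive1n m h) r 1.

Record vortex_profiles (n : nat) (lam : R) (f beta : R -> R) : Prop := {
  f_smooth : smooth_pos f;
  beta_smooth : smooth_pos beta;
  f_eq : forall r, 0 < r ->
    derive1n 2 f r + r^-1 * derive1 f r
    - n%:R ^+ 2 / r ^+ 2 * (1 - beta r) ^+ 2 * f r
    + lam / 2 * (1 - f r ^+ 2) * f r = 0;
  beta_eq : forall r, 0 < r ->
    derive1n 2 beta r - r^-1 * derive1 beta r + f r ^+ 2 * (1 - beta r) = 0;
  f_0 : f 0 = 0;
  beta_0 : beta 0 = 0;
  f_cont0 : f r @[r --> 0^'+] --> (0 : R);
  beta_cont0 : beta r @[r --> 0^'+] --> (0 : R);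
  f_infty : f r @[r --> +oo] --> (1 : R);
  beta_infty : beta r @[r --> +oo] --> (1 : R)
}.

Definition vortex_polar (n : nat) (f beta : R -> R) : field := Field
  (fun r th => - (n%:R * beta r / r * sin th))
  (fun r th => n%:R * beta r / r * cos th)
  (fun r th => f r * cos (n%:R * th))
  (fun r th => f r * sin (n%:R * th)).

Section Operator.
Variables (lam : R) (Psi : field).

Definition covD1_psi1 x y := partial1 (sca1 Psi) x y + vec1 Psi x y * sca2 Psi x y.
Definition covD1_psi2 x y := partial1 (sca2 Psi) x y - vec1 Psi x y * sca1 Psi x y.
Definition covD2_psi1 x y := partial2 (sca1 Psi) x y + vec2 Psi x y * sca2 Psi x y.
Definition covD2_psi2 x y := partial2 (sca2 Psi) x y - vec2 Psi x y * sca1 Psi x y.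

Definition psi_sq x y := sca1 Psi x y ^+ 2 + sca2 Psi x y ^+ 2.
Definition V_sq x y := vec1 Psi x y ^+ 2 + vec2 Psi x y ^+ 2.
Definition V_grad (h : R -> R -> R) x y :=
  vec1 Psi x y * partial1 h x y + vec2 Psi x y * partial2 h x y.

Definition Hplus (xi : field) : field := Field
  (fun x y =>
     - laplacian (vec1 xi) x y + psi_sq x y * vec1 xi x y
     - 2 * covD1_psi2 x y * sca1 xi x y
     + 2 * covD1_psi1 x y * sca2 xi x y)
  (fun x y =>
     - laplacian (vec2 xi) x y + psi_sq x y * vec2 xi x y
     - 2 * covD2_psi2 x y * sca1 xi x y
     + 2 * covD2_psi1 x y * sca2 xi x y)
  (fun x y =>
     - 2 * covD1_psi2 x y * vec1 xi x y
     - 2 * covD2_psi2 x y * vec2 xi x y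
     + (- laplacian (sca1 xi) x y
        + (3 * lam / 2 * sca1 Psi x y ^+ 2
           + (1 + lam / 2) * sca2 Psi x y ^+ 2
           - lam / 2 + V_sq x y) * sca1 xi x y)
     + (- 2 * V_grad (sca2 xi) x y
        + (lam - 1) * sca1 Psi x y * sca2 Psi x y * sca2 xi x y))
  (fun x y =>
     2 * covD1_psi1 x y * vec1 xi x y
     + 2 * covD2_psi1 x y * vec2 xi x y
     + (2 * V_grad (sca1 xi) x y
        + (lam - 1) * sca1 Psi x y * sca2 Psi x y * sca1 xi x y)
     + (- laplacian (sca2 xi) x y
        + ((1 + lam / 2) * sca1 Psi x y ^+ 2
           + 3 * lam / 2 * sca2 Psi x y ^+ 2
           - lam / 2 + V_sq x y) * sca2 xi x y)).

(* [om2] stands for omega^2; it is a real number of arbitrary sign, since the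
   vortex may be unstable. The equations are imposed on the punctured plane,
   the radial functions being smooth on r > 0 only. *)
Definition eigen_eq (om2 : R) (xi : field) : Prop :=
  forall x y : R, (x, y) != (0, 0) ->
    [/\ vec1 (Hplus xi) x y = om2 * vec1 xi x y,
        vec2 (Hplus xi) x y = om2 * vec2 xi x y,
        sca1 (Hplus xi) x y = om2 * sca1 xi x y
      & sca2 (Hplus xi) x y = om2 * sca2 xi x y].

Definition background_gauge (xi : field) : Prop :=
  forall x y : R, (x, y) != (0, 0) ->
    partial1 (vec1 xi) x y + partial2 (vec2 xi) x y
    - (sca1 Psi x y * sca2 xi x y - sca2 Psi x y * sca1 xi x y) = 0.

End Operator.

Definition admissible0 (n : nat) (xi : field) : Prop :=
  exists g t : R -> R, [/\ smooth_pos g, smooth_pos t &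
    polar_form xi (Field
      (fun r th => - g r * sin th)
      (fun r th => g r * cos th)
      (fun r th => t r * cos (n%:R * th))
      (fun r th => t r * sin (n%:R * th)))].

Definition admissible (n k : nat) (xi : field) : Prop :=
  exists g1 g2 t1 t2 : R -> R,
    [/\ smooth_pos g1, smooth_pos g2, smooth_pos t1, smooth_pos t2 &
    polar_form xi (Field
      (fun r th => - g1 r * sin ((1 - k%:R) * th) - g2 r * sin ((1 + k%:R) * th))
      (fun r th => g1 r * cos ((1 - k%:R) * th) + g2 r * cos ((1 + k%:R) * th))
      (fun r th => t1 r * cos ((n%:R - k%:R) * th) + t2 r * cos ((n%:R + k%:R) * th))
      (fun r th => t1 r * sin ((n%:R - k%:R) * th) + t2 r * sin ((n%:R + k%:R) * th)))].

Definition derrick_polar (n : nat) (v u : R -> R) : field := Field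
  (fun r th => v r * sin th)
  (fun r th => - v r * cos th)
  (fun r th => u r * cos (n%:R * th))
  (fun r th => u r * sin (n%:R * th)).

(* The displayed multipolar form, with C and S in the places of
   cos (k theta) and sin (k theta). *)
Definition multipolar_form (n k : nat) (f : R -> R) (C S : R -> R)
    (v u w : R -> R) : field := Field
  (fun r th => C th * sin th * (derive1 v r - r * f r * w r)
               - S th * cos th * (k%:R * v r / r))
  (fun r th => - (C th * cos th * (derive1 v r - r * f r * w r))
               - S th * sin th * (k%:R * v r / r))
  (fun r th => C th * cos (n%:R * th) * u r
               + k%:R * S th * sin (n%:R * th) * w r)
  (fun r th => C th * sin (n%:R * th) * u r
               - k%:R * S th * cos (n%:R * th) * w r).

Definition xi_polar (n k : nat) (f v u w : R -> R) : field :=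
  multipolar_form n k f
    (fun th => cos (k%:R * th)) (fun th => sin (k%:R * th)) v u w.

Definition chi_polar (n k : nat) (f v u w : R -> R) : field :=
  multipolar_form n k f
    (fun th => sin (k%:R * th)) (fun th => - cos (k%:R * th)) v u w.

Definition Hbar0_eq (n : nat) (lam : R) (f beta : R -> R) (om2 : R)
    (v u : R -> R) : Prop :=
  forall r : R, 0 < r ->
    (- derive1n 2 v r - r^-1 * derive1 v r + (1 / r ^+ 2 + f r ^+ 2) * v r
     + 2 * n%:R / r * (1 - beta r) * f r * u r = om2 * v r)
    /\
    (2 * n%:R / r * (1 - beta r) * f r * v r
     + (- derive1n 2 u r - r^-1 * derive1 u r
        + (n%:R ^+ 2 * (1 - beta r) ^+ 2 / r ^+ 2
           + 3 * lam / 2 * f r ^+ 2 - lam / 2) * u r) = om2 * u r).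

Definition Lradial (k : nat) (h : R -> R) (r : R) : R :=
  - derive1n 2 h r - r^-1 * derive1 h r + k%:R ^+ 2 / r ^+ 2 * h r.

Definition Hbar_eq (n k : nat) (lam : R) (f beta : R -> R) (om2 : R)
    (v u w : R -> R) : Prop :=
  forall r : R, 0 < r ->
    [/\ Lradial k v r + f r ^+ 2 * v r
        + 2 * (f r + r * derive1 f r) * w r = om2 * v r,
        2 * n%:R * (1 - beta r) * f r / r * derive1 v r
        + (Lradial k u r
           + (n%:R ^+ 2 * (1 - beta r) ^+ 2 / r ^+ 2
              + 3 * lam / 2 * f r ^+ 2 - lam / 2) * u r)
        - 2 * n%:R * (1 - beta r) * (k%:R ^+ 2 + r ^+ 2 * f r ^+ 2) / r ^+ 2
          * w r = om2 * u r
      & 2 * derive1 f r / r * v r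
        - 2 * n%:R * (1 - beta r) / r ^+ 2 * u r
        + (Lradial k w r
           + (n%:R ^+ 2 * (1 - beta r) ^+ 2 / r ^+ 2
              + f r ^+ 2 + lam / 2 * f r ^+ 2 - lam / 2) * w r) = om2 * w r].

Definition pairing (xi chi : field) (x y : R) : R :=
  vec1 xi x y * vec1 chi x y + vec2 xi x y * vec2 chi x y
  + sca1 xi x y * sca1 chi x y + sca2 xi x y * sca2 chi x y.

Definition plane_measure := (@lebesgue_measure R \x @lebesgue_measure R)%E.

(* The inner product is only meaningful when the pairing is integrable on the
   plane; the vanishing of the angular integrals is unconditional. *)
Definition orthogonal_fields (xi chi : field) : Prop :=
  (forall r : R, 0 < r ->
     (\int[@lebesgue_measure R]_(th in `[0%R, (2 * pi)%R])
        (pairing xi chi (r * cos th) (r * sin th))%:E = 0)%E)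
  /\
  (plane_measure.-integrable setT (fun p => (pairing xi chi p.1 p.2)%:E) ->
     (\int[plane_measure]_p (pairing xi chi p.1 p.2)%:E = 0)%E).

Definition lin_indep (xi chi : field) : Prop :=
  forall c d : R,
    (forall x y : R, (x, y) != (0, 0) ->
      [/\ c * vec1 xi x y + d * vec1 chi x y = 0,
          c * vec2 xi x y + d * vec2 chi x y = 0,
          c * sca1 xi x y + d * sca1 chi x y = 0
        & c * sca2 xi x y + d * sca2 chi x y = 0]) ->
    c = 0 /\ d = 0.

Definition nonzero_triple (v u w : R -> R) : Prop :=
  exists2 r : R, 0 < r & [|| v r != 0, u r != 0 | w r != 0].

End Fields.

(* Main.v *)
Require Import Defs.
From HB Require Import structures.
From mathcomp Require Import all_boot all_order all_algebra.
From mathcomp Require Import all_classical all_reals all_analysis.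
From mathcomp Require Import measurable_realfun ring lra.
Import Order.TTheory GRing.Theory Num.Theory.
Import numFieldNormedType.Exports.

Set Implicit Arguments.
Unset Strict Implicit.
Unset Printing Implicit Defensive.

Local Open Scope ring_scope.
Local Open Scope classical_set_scope.

(* In polar coordinates and in the rotated frame
   [a_r = A S], [a_theta = B C], [phi e^(-i n theta) = U C + i W S], where [C]
   and [S] are [cos (k theta)] and [sin (k theta)] (or their quarter-period
   shift for [chi], or the constants [1] and [0] for the Derrick modes), the
   operator [Hplus] preserves the shape of the field, and the eigenvalue
   equation becomes four radial equations with angular factors [S], [C], [C],
   [S]. The gauge condition [A' + A/r - k B/r - f W = 0] is solved by the
   potential [v]: [A = - k v / r], [B = - (v' - r f w)], [W = - k w], and the
   four radial equations then reduce to the three equations of [Hbar].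

   Cartesian derivatives are computed along curves through the local angle
   [th + atan (Y / X)], [(X, Y)] being Cartesian coordinates rotated by [th].

   The pairing of [xi] and [chi] is [G r * cos (k theta) * sin (k theta)], which
   is odd under [y -> - y], hence has zero integral over the plane by Fubini. *)

Section RealDerivatives.
Context {R : realType}.
Implicit Types (f g h : R -> R) (s a b : R).

Lemma is_derive_add f g s a b : is_derive s 1 f a -> is_derive s 1 g b ->
  is_derive s 1 (fun t => f t + g t) (a + b).
Proof. by move=> fa gb; exact: is_deriveD. Qed.

Lemma is_derive_opp f s a : is_derive s 1 f a ->
  is_derive s 1 (fun t => - f t) (- a).
Proof. by move=> fa; exact: is_deriveN. Qed.

Lemma is_derive_mul f g s a b : is_derive s 1 f a -> is_derive s 1 g b ->
  is_derive s 1 (fun t => f t * g t) (a * g s + f s * b).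
Proof.
move=> fa gb; apply: is_derive_eq (is_deriveM fa gb) _.
by rewrite /GRing.scale/= addrC (mulrC (g s)).
Qed.

Lemma is_derive_const (c : R) s : is_derive s 1 (fun=> c) 0.
Proof. exact: is_derive_cst. Qed.

Lemma is_derive_ident s : is_derive s 1 (fun t : R => t) 1.
Proof. exact: is_derive_id. Qed.

Lemma is_derive_scale (c : R) f s a : is_derive s 1 f a ->
  is_derive s 1 (fun t => c * f t) (c * a).
Proof.
move=> fa; apply: is_derive_eq (is_derive_mul (is_derive_const c s) fa) _.
by rewrite mul0r add0r.
Qed.

Lemma is_derive_inv f s a : f s != 0 -> is_derive s 1 f a ->
  is_derive s 1 (fun t => (f t)^-1) (- (a / f s ^+ 2)).
Proof.
move=> f0 fa; apply: is_derive_eq (is_deriveV f0 fa) _.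
by rewrite /GRing.scale/= mulNr mulrC.
Qed.

Lemma is_derive_invr s : 0 < s ->
  is_derive s 1 (fun t : R => t^-1) (- s ^- 2).
Proof.
move=> s0; have sn0 : s != 0 by rewrite gt_eqF.
apply: is_derive_eq (is_derive_inv (f := fun t => t) sn0 (is_derive_ident s)) _.
by rewrite mul1r.
Qed.

Lemma is_derive_comp f g s a b : is_derive (g s) 1 f a -> is_derive s 1 g b ->
  is_derive s 1 (fun t => f (g t)) (a * b).
Proof. by move=> fa gb; exact: (is_derive1_comp fa gb). Qed.

Lemma is_derive_derive1 f s a : is_derive s 1 f a -> derive1 f s = a.
Proof. by move=> fa; rewrite derive1E; exact: derive_val. Qed.

Lemma derivable_is_derive f s : derivable f s 1 -> is_derive s 1 f (derive1 f s).
Proof. by move=> /derivableP; rewrite derive1E. Qed.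

Lemma near_pos s : 0 < s -> \forall t \near s, 0 < t.
Proof. by move=> s0; exact: lt_nbhsr. Qed.

Lemma is_derive_pos_eq f g s a : 0 < s -> (forall t, 0 < t -> f t = g t) ->
  is_derive s 1 f a -> is_derive s 1 g a.
Proof.
move=> s0 fg; apply: near_eq_is_derive.
by apply: filterS (near_pos s0) => t t0; exact: fg.
Qed.

Lemma derive1_pos_eq f g s : 0 < s -> (forall t, 0 < t -> f t = g t) ->
  derive1 f s = derive1 g s.
Proof.
move=> s0 fg; rewrite !derive1E; apply: near_eq_derive.
by apply: filterS (near_pos s0) => t t0; exact: fg.
Qed.

Lemma is_derive_continuous f s a : is_derive s 1 f a -> {for s, continuous f}.
Proof.
by case=> fa _; exact/differentiable_continuous/derivable1_diffP.
Qed.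

Lemma is_derive_near_pos f s a : 0 < f s -> is_derive s 1 f a ->
  \forall t \near s, 0 < f t.
Proof.
move=> fs0 /is_derive_continuous fc.
exact: (fc (fun t => 0 < t) (lt_nbhsr fs0)).
Qed.

Lemma is_derive_cos_mul (c s : R) :
  is_derive s 1 (fun t => cos (c * t)) (- c * sin (c * s)).
Proof.
have H := is_derive_comp (is_derive_cos (c * s))
  (is_derive_scale c (is_derive_ident s)).
by apply: is_derive_eq H _; ring.
Qed.

Lemma is_derive_sin_mul (c s : R) :
  is_derive s 1 (fun t => sin (c * t)) (c * cos (c * s)).
Proof.
have H := is_derive_comp (is_derive_sin (c * s))
  (is_derive_scale c (is_derive_ident s)).
by apply: is_derive_eq H _; ring.
Qed.

End RealDerivatives.

Section Smooth.
Context {R : realType}.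
Implicit Types (f g h : R -> R) (r : R).

Lemma smooth_is_derive f r : smooth_pos f -> 0 < r ->
  is_derive r 1 f (derive1 f r).
Proof. by move=> sf r0; apply/derivable_is_derive/(sf 0%N). Qed.

Lemma smooth_derive1 f : smooth_pos f -> smooth_pos (derive1 f).
Proof. by move=> sf m r r0; rewrite -derive1Sn; exact: sf. Qed.

Lemma smooth_coind (P : (R -> R) -> Prop) :
  (forall f, P f -> exists2 f', P f' &
     forall r, 0 < r -> is_derive r 1 f (f' r)) ->
  forall f, P f -> smooth_pos f.
Proof.
move=> HP f Pf m.
suff: forall g, (forall r, 0 < r -> f r = g r) ->
    forall r, 0 < r -> derivable (derive1n m g) r 1 by exact.
elim: m f Pf => [|m IH] f Pf g fg r r0; have [f' Pf' ff'] := HP _ Pf.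
  exact: (@ex_derive _ _ _ _ _ _ _ (is_derive_pos_eq r0 fg (ff' _ r0))).
rewrite derive1Sn; apply: (IH f') => // t t0.
by rewrite (is_derive_derive1 (is_derive_pos_eq t0 fg (ff' _ t0))).
Qed.

(* Closing the class of smooth functions under these operations first makes
   the iterated derivatives of products manageable: the derivative of a
   generated function is again generated. *)
Inductive smooth_gen : (R -> R) -> Prop :=
| gen_smooth f : smooth_pos f -> smooth_gen f
| gen_const c : smooth_gen (fun=> c)
| gen_ident : smooth_gen (fun r => r)
| gen_inv : smooth_gen (fun r => r^-1)
| gen_add f g : smooth_gen f -> smooth_gen g -> smooth_gen (fun r => f r + g r)
| gen_mul f g : smooth_gen f -> smooth_gen g -> smooth_gen (fun r => f r * g r).

Lemma smooth_genP f : smooth_gen f -> smooth_pos f.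
Proof.
apply: smooth_coind => {f} f; elim=> {f}
  [f sf|c|||f g _ [f' gf' df] _ [g' gg' dg]|f g gf [f' gf' df] gg [g' gg' dg]].
- exists (derive1 f); first exact/gen_smooth/smooth_derive1.
  by move=> r; exact: smooth_is_derive.
- by exists (fun=> 0); [exact: gen_const|move=> r _; exact: is_derive_const].
- by exists (fun=> 1); [exact: gen_const|move=> r _; exact: is_derive_ident].
- exists (fun r => -1 * (r^-1 * r^-1)).
    by apply/gen_mul/gen_mul => //; [exact: gen_const|exact: gen_inv|exact: gen_inv].
  move=> r r0; apply: is_derive_eq (is_derive_invr r0) _.
  by field; rewrite gt_eqF.
- exists (fun r => f' r + g' r); first exact: gen_add.
  by move=> r r0; apply: is_derive_add; [exact: df|exact: dg].
- exists (fun r => f' r * g r + f r * g' r).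
    by apply: gen_add; exact: gen_mul.
  by move=> r r0; apply: is_derive_mul; [exact: df|exact: dg].
Qed.

Lemma smooth_eq f g : (forall r, f r = g r) -> smooth_pos f -> smooth_pos g.
Proof. by move=> /funext ->. Qed.

End Smooth.

Section PolarCalculus.
Context {R : realType}.
Implicit Types (h F : R -> R -> R) (r th : R).

Definition polar_rep h F :=
  forall r th, 0 < r -> h (r * cos th) (r * sin th) = F r th.

(* [F] has partial derivatives [Fr] and [Ft] in the strong sense that the chain
   rule holds along every differentiable curve with positive radius. *)
Definition polar_diff F Fr Ft :=
  forall (rho tau : R -> R) (s dr dt : R), 0 < rho s ->
    is_derive s 1 rho dr -> is_derive s 1 tau dt ->
    is_derive s 1 (fun t => F (rho t) (tau t))
      (dr * Fr (rho s) (tau s) + dt * Ft (rho s) (tau s)).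

Lemma polar_diff_separable (a a' b b' : R -> R) :
  (forall r, 0 < r -> is_derive r 1 a (a' r)) ->
  (forall th, is_derive th 1 b (b' th)) ->
  polar_diff (fun r th => a r * b th)
    (fun r th => a' r * b th) (fun r th => a r * b' th).
Proof.
move=> da db rho tau s dr dt r0 drho dtau.
apply: is_derive_eq (is_derive_mul (is_derive_comp (da _ r0) drho)
  (is_derive_comp (db _) dtau)) _.
ring.
Qed.

Lemma polar_diff_add F Fr Ft G Gr Gt :
  polar_diff F Fr Ft -> polar_diff G Gr Gt ->
  polar_diff (fun r th => F r th + G r th)
    (fun r th => Fr r th + Gr r th) (fun r th => Ft r th + Gt r th).
Proof.
move=> dF dG rho tau s dr dt r0 drho dtau.
apply: is_derive_eq (is_derive_add (dF _ _ _ _ _ r0 drho dtau)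
  (dG _ _ _ _ _ r0 drho dtau)) _.
ring.
Qed.

Lemma cos_sin_atan (X Y : R) : 0 < X ->
  Num.sqrt (X ^+ 2 + Y ^+ 2) * cos (atan (Y / X)) = X /\
  Num.sqrt (X ^+ 2 + Y ^+ 2) * sin (atan (Y / X)) = Y.
Proof.
move=> X0; have Xn0 : X != 0 by rewrite gt_eqF.
have C0 : Num.sqrt (1 + (Y / X) ^+ 2) != 0.
  by rewrite gt_eqF// sqrtr_gt0 ltr_wpDr// sqr_ge0.
have E : Num.sqrt (X ^+ 2 + Y ^+ 2) = X * Num.sqrt (1 + (Y / X) ^+ 2).
  rewrite -[X in X * Num.sqrt _](gtr0_norm X0) -sqrtr_sqr -sqrtrM ?sqr_ge0//.
  by congr Num.sqrt; field.
have cE := cos_atan (Y / X).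
have H1 : Num.sqrt (X ^+ 2 + Y ^+ 2) * cos (atan (Y / X)) = X.
  by rewrite cE E; field.
split => //.
have : tan (atan (Y / X)) = Y / X by rewrite atanK.
rewrite /tan => /(congr1 (fun t => t * cos (atan (Y / X)))).
rewrite divfK ?cE ?invr_eq0// -cE => ->.
by rewrite mulrCA H1; field.
Qed.

Lemma polar_curve h F Fr Ft : polar_rep h F -> polar_diff F Fr Ft ->
  forall (x y : R -> R) (s dx dy r th : R), 0 < r ->
    x s = r * cos th -> y s = r * sin th ->
    is_derive s 1 x dx -> is_derive s 1 y dy ->
  is_derive s 1 (fun t => h (x t) (y t))
    ((cos th * dx + sin th * dy) * Fr r th
     + (- sin th * dx + cos th * dy) / r * Ft r th).
Proof.
move=> hF dF x y s dx dy r th r0 xs ys xd yd.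
have rn0 : r != 0 by rewrite gt_eqF.
have cs := cos2sin2 th; set c := cos th in xs cs *; set sn := sin th in ys cs *.
pose X t := c * x t + sn * y t; pose Y t := - sn * x t + c * y t.
have Xs : X s = r by rewrite /X xs ys; ring: cs.
have Ys : Y s = 0 by rewrite /Y xs ys; ring.
have dX : is_derive s 1 X (c * dx + sn * dy).
  by apply: is_derive_add; exact: is_derive_scale.
have dY : is_derive s 1 Y (- sn * dx + c * dy).
  by apply: is_derive_add; exact: is_derive_scale.
pose N t := X t * X t + Y t * Y t.
pose rho t := Num.sqrt (N t); pose tau t := th + atan (Y t * (X t)^-1).
have Ns : N s = r ^+ 2 by rewrite /N Xs Ys; ring.
have rhos : rho s = r by rewrite /rho Ns sqrtr_sqr gtr0_norm.
have taus : tau s = th by rewrite /tau Ys mul0r atan0 addr0.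
have drho : is_derive s 1 rho (c * dx + sn * dy).
  have N0 : 0 < N s by rewrite Ns exprn_gt0.
  have dN := is_derive_add (is_derive_mul dX dX)
    (is_derive_mul dY dY).
  apply: is_derive_eq (is_derive_comp (is_derive1_sqrt N0) dN) _.
  by rewrite -/(rho s) rhos Xs Ys; field.
have dtau : is_derive s 1 tau ((- sn * dx + c * dy) / r).
  have X0 : X s != 0 by rewrite Xs.
  have dq := is_derive_mul dY (is_derive_inv X0 dX).
  have dA := is_derive_comp (g := fun t => Y t * (X t)^-1)
    (is_derive1_atan (Y s * (X s)^-1)) dq.
  apply: is_derive_eq (is_derive_add (is_derive_const th s) dA) _.
  by rewrite Xs Ys; field; rewrite rn0 /=.
have rho0 : 0 < rho s by rewrite rhos.
have := dF rho tau s _ _ rho0 drho dtau; rewrite rhos taus.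
apply: near_eq_is_derive.
have X0 : 0 < X s by rewrite Xs.
apply: filterS (is_derive_near_pos X0 dX) => t Xt.
have [H1 H2] := cos_sin_atan (Y t) Xt.
rewrite -hF; last first.
  by rewrite /rho /N sqrtr_gt0 ltr_wpDr ?mulr_gt0// -expr2 sqr_ge0.
rewrite /rho /N /tau -!expr2 cosD sinD -/c -/sn; congr (h _ _).
  by rewrite mulrBr mulrCA H1 mulrCA H2 /X /Y; ring: cs.
by rewrite mulrDr mulrCA H1 mulrCA H2 /X /Y; ring: cs.
Qed.

Lemma partial1_polar h F Fr Ft : polar_rep h F -> polar_diff F Fr Ft ->
  polar_rep (partial1 h) (fun r th => cos th * Fr r th - sin th / r * Ft r th).
Proof.
move=> hF dF r th r0; rewrite /partial1; apply: is_derive_derive1.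
apply: is_derive_eq (polar_curve hF dF (x := id) (y := fun=> r * sin th) r0
  erefl erefl (is_derive_ident _) (is_derive_const _ _)) _.
by ring.
Qed.

Lemma partial2_polar h F Fr Ft : polar_rep h F -> polar_diff F Fr Ft ->
  polar_rep (partial2 h) (fun r th => sin th * Fr r th + cos th / r * Ft r th).
Proof.
move=> hF dF r th r0; rewrite /partial2; apply: is_derive_derive1.
apply: is_derive_eq (polar_curve hF dF (x := fun=> r * cos th) (y := id) r0
  erefl erefl (is_derive_const _ _) (is_derive_ident _)) _.
by ring.
Qed.

Lemma polar_diff_mul F Fr Ft G Gr Gt :
  polar_diff F Fr Ft -> polar_diff G Gr Gt ->
  polar_diff (fun r th => F r th * G r th)
    (fun r th => Fr r th * G r th + F r th * Gr r th)
    (fun r th => Ft r th * G r th + F r th * Gt r th).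
Proof.
move=> dF dG rho tau s dr dt r0 drho dtau.
apply: is_derive_eq (is_derive_mul (dF _ _ _ _ _ r0 drho dtau)
  (dG _ _ _ _ _ r0 drho dtau)) _.
ring.
Qed.

Lemma polar_diff_radial (a a' : R -> R) :
  (forall r, 0 < r -> is_derive r 1 a (a' r)) ->
  polar_diff (fun r _ => a r) (fun r _ => a' r) (fun _ _ => 0).
Proof.
move=> da rho tau s dr dt r0 drho dtau.
by apply: is_derive_eq (is_derive_comp (da _ r0) drho) _; ring.
Qed.

Lemma polar_diff_angular (b b' : R -> R) :
  (forall th, is_derive th 1 b (b' th)) ->
  polar_diff (fun _ th => b th) (fun _ _ => 0) (fun _ th => b' th).
Proof.
move=> db rho tau s dr dt r0 drho dtau.
by apply: is_derive_eq (is_derive_comp (db _) dtau) _; ring.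
Qed.

Lemma laplacian_polar h F Fr Ft Frr Frt Ftt :
  polar_rep h F -> polar_diff F Fr Ft ->
  polar_diff Fr Frr Frt -> polar_diff Ft Frt Ftt ->
  polar_rep (laplacian h)
    (fun r th => Frr r th + Fr r th / r + Ftt r th / r ^+ 2).
Proof.
move=> hF dF dFr dFt r th r0.
have rn0 : r != 0 by rewrite gt_eqF.
have dc (t : R) : is_derive t 1 (@cos R) (- sin t) by exact: is_derive_cos.
have ds (t : R) : is_derive t 1 (@sin R) (cos t) by exact: is_derive_sin.
have dsN (t : R) : is_derive t 1 (fun t : R => - sin t) (- cos t).
  exact: (is_derive_opp (ds t)).
have d1 := polar_diff_add
  (polar_diff_mul (polar_diff_angular dc) dFr)
  (polar_diff_mul (polar_diff_mul
    (polar_diff_angular dsN) (polar_diff_radial (@is_derive_invr R))) dFt).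
have d2 := polar_diff_add
  (polar_diff_mul (polar_diff_angular ds) dFr)
  (polar_diff_mul (polar_diff_mul
    (polar_diff_angular dc) (polar_diff_radial (@is_derive_invr R))) dFt).
have r1 : polar_rep (partial1 h)
    (fun r th => cos th * Fr r th + - sin th * r^-1 * Ft r th).
  by move=> ? ? ?; rewrite (partial1_polar hF dF)// !mulNr.
have r2 : polar_rep (partial2 h)
    (fun r th => sin th * Fr r th + cos th * r^-1 * Ft r th).
  by move=> ? ? ?; rewrite (partial2_polar hF dF).
rewrite /laplacian (partial1_polar r1 d1)// (partial2_polar r2 d2)//.
have cs := cos2sin2 th.
by field: cs.
Qed.

End PolarCalculus.

Section PolarCoordinates.
Context {R : realType}.
Implicit Types x y r th : R.

Lemma polar_coordinates x y : (x, y) != (0, 0) ->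
  exists r th, [/\ 0 < r, x = r * cos th & y = r * sin th].
Proof.
move=> xy0; pose r := Num.sqrt (x ^+ 2 + y ^+ 2).
have s0 : 0 < x ^+ 2 + y ^+ 2.
  rewrite lt_neqAle addr_ge0 ?sqr_ge0// andbT eq_sym paddr_eq0 ?sqr_ge0//.
  by rewrite !sqrf_eq0; apply: contra xy0 => /andP[/eqP -> /eqP ->].
have r0 : 0 < r by rewrite sqrtr_gt0.
have rr : r ^+ 2 = x ^+ 2 + y ^+ 2 by rewrite sqr_sqrtr// ltW.
have rn0 : r != 0 by rewrite gt_eqF.
have xr1 : (x / r) ^+ 2 <= 1.
  by rewrite expr_div_n rr ler_pdivrMr// mul1r lerDl sqr_ge0.
have xr : -1 <= x / r <= 1 by rewrite -ler_norml -(@expr_le1 _ 2)// real_normK ?num_real.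
have cE : r * cos (acos (x / r)) = x by rewrite acosK ?in_itv//; field.
have sE : r * sin (acos (x / r)) = `|y|.
  rewrite sin_acos// -[X in X * _](gtr0_norm r0) -sqrtr_sqr -sqrtrM ?sqr_ge0//.
  rewrite -sqrtr_sqr; congr Num.sqrt.
  by rewrite mulrBr mulr1 expr_div_n mulrCA divff ?expf_neq0// mulr1 rr; ring.
have [y0|y0] := leP 0 y.
  by exists r, (acos (x / r)); split=> //; rewrite sE ger0_norm.
exists r, (- acos (x / r)); split=> //; first by rewrite cosN.
by rewrite sinN mulrN sE ltr0_norm// opprK.
Qed.

Lemma polar_neq0 r th : 0 < r -> (r * cos th, r * sin th) != (0, 0).
Proof.
move=> r0; apply/eqP => -[/eqP]; rewrite mulf_eq0 gt_eqF//= => /eqP c0 /eqP.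
rewrite mulf_eq0 gt_eqF//= => /eqP s0.
by have := cos2Dsin2 th; rewrite c0 s0 expr0n addr0 => /esym/eqP; rewrite oner_eq0.
Qed.

Lemma polar_forall (P : R -> R -> Prop) :
  (forall x y, (x, y) != (0, 0) -> P x y) <->
  (forall r th, 0 < r -> P (r * cos th) (r * sin th)).
Proof.
split=> [H r th r0|H x y /polar_coordinates[r [th [r0 -> ->]]]]; last exact: H.
exact/H/polar_neq0.
Qed.

End PolarCoordinates.

Section Waves.
Context {R : realType}.

Definition wave (m : R) (X X' : R -> R) :=
  (forall th : R, is_derive th 1 X (X' th)) /\
  (forall th : R, is_derive th 1 X' (- m ^+ 2 * X th)).

Lemma wave_cos (m : R) : wave m (fun th => cos (m * th)) (fun th => - m * sin (m * th)).
Proof.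
split=> th; first exact: is_derive_cos_mul.
by apply: is_derive_eq (is_derive_scale (- m) (is_derive_sin_mul m th)) _; ring.
Qed.

Lemma wave_sin (m : R) : wave m (fun th => sin (m * th)) (fun th => m * cos (m * th)).
Proof.
split=> th; first exact: is_derive_sin_mul.
by apply: is_derive_eq (is_derive_scale m (is_derive_cos_mul m th)) _; ring.
Qed.

Lemma wave_opp (m : R) X X' : wave m X X' ->
  wave m (fun th => - X th) (fun th => - X' th).
Proof.
move=> [d d']; split=> th; first exact: is_derive_opp.
by apply: is_derive_eq (is_derive_opp (d' th)) _; ring.
Qed.

Lemma wave1_cos : wave 1 (@cos R) (fun th => - sin th).
Proof.
have -> : @cos R = (fun th => cos (1 * th)) by apply/funext => th; rewrite mul1r.
have -> : (fun th : R => - sin th) = (fun th => - 1 * sin (1 * th)).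
  by apply/funext => th; rewrite mul1r mulN1r.
exact: wave_cos.
Qed.

Lemma wave1_sin : wave 1 (@sin R) (@cos R).
Proof.
have -> : @sin R = (fun th => sin (1 * th)) by apply/funext => th; rewrite mul1r.
have -> : @cos R = (fun th => 1 * cos (1 * th)).
  by apply/funext => th; rewrite !mul1r.
exact: wave_sin.
Qed.

Lemma wave_calculus (l m : R) (h : R -> R -> R)
    (a1 X1 X1' Y1 Y1' a2 X2 X2' Y2 Y2' : R -> R) :
  smooth_pos a1 -> wave l X1 X1' -> wave m Y1 Y1' ->
  smooth_pos a2 -> wave l X2 X2' -> wave m Y2 Y2' ->
  polar_rep h (fun r th => a1 r * (X1 th * Y1 th) + a2 r * (X2 th * Y2 th)) ->
  forall r th, 0 < r ->
  [/\ partial1 h (r * cos th) (r * sin th) =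
        cos th * (derive1 a1 r * (X1 th * Y1 th) + derive1 a2 r * (X2 th * Y2 th))
        - sin th / r * (a1 r * (X1' th * Y1 th + X1 th * Y1' th)
                        + a2 r * (X2' th * Y2 th + X2 th * Y2' th)),
      partial2 h (r * cos th) (r * sin th) =
        sin th * (derive1 a1 r * (X1 th * Y1 th) + derive1 a2 r * (X2 th * Y2 th))
        + cos th / r * (a1 r * (X1' th * Y1 th + X1 th * Y1' th)
                        + a2 r * (X2' th * Y2 th + X2 th * Y2' th))
    & laplacian h (r * cos th) (r * sin th) =
        (derive1 (derive1 a1) r + derive1 a1 r / r - (l ^+ 2 + m ^+ 2) / r ^+ 2 * a1 r)
          * (X1 th * Y1 th)
        + 2 / r ^+ 2 * a1 r * (X1' th * Y1' th)
        + (derive1 (derive1 a2) r + derive1 a2 r / r - (l ^+ 2 + m ^+ 2) / r ^+ 2 * a2 r)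
          * (X2 th * Y2 th)
        + 2 / r ^+ 2 * a2 r * (X2' th * Y2' th)].
Proof.
move=> s1 [dX1 dX1'] [dY1 dY1'] s2 [dX2 dX2'] [dY2 dY2'] hF r th r0.
have da (a : R -> R) : smooth_pos a ->
    forall r : R, 0 < r -> is_derive r 1 a (derive1 a r).
  by move=> sa t; exact: smooth_is_derive.
have dp (X X' Y Y' : R -> R) : (forall th : R, is_derive th 1 X (X' th)) ->
    (forall th : R, is_derive th 1 Y (Y' th)) ->
    forall th : R, is_derive th 1 (fun t => X t * Y t) (X' th * Y th + X th * Y' th).
  by move=> dX dY t; exact: is_derive_mul.
have ds (X X' Y Y' : R -> R) : (forall th : R, is_derive th 1 X (X' th)) ->
    (forall th : R, is_derive th 1 Y (Y' th)) ->
    forall th : R, is_derive th 1 (fun t => X t + Y t) (X' th + Y' th).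
  by move=> dX dY t; exact: is_derive_add.
have s1' := smooth_derive1 s1; have s2' := smooth_derive1 s2.
have d1 := dp _ _ _ _ dX1 dY1; have d2 := dp _ _ _ _ dX2 dY2.
have d1' := ds _ _ _ _ (dp _ _ _ _ dX1' dY1) (dp _ _ _ _ dX1 dY1').
have d2' := ds _ _ _ _ (dp _ _ _ _ dX2' dY2) (dp _ _ _ _ dX2 dY2').
have dF := polar_diff_add (polar_diff_separable (da _ s1) d1)
  (polar_diff_separable (da _ s2) d2).
have dFr := polar_diff_add (polar_diff_separable (da _ s1') d1)
  (polar_diff_separable (da _ s2') d2).
have dFt := polar_diff_add (polar_diff_separable (da _ s1) d1')
  (polar_diff_separable (da _ s2) d2').
split; first by rewrite (partial1_polar hF dF).
  by rewrite (partial2_polar hF dF).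
rewrite (laplacian_polar hF dF dFr dFt)//.
have : r != 0 by rewrite gt_eqF.
move: (a1 r) (a2 r) (X1 th) (X2 th) (Y1 th) (Y2 th) (X1' th) (X2' th) (Y1' th)
  (Y2' th) (derive1 a1 r) (derive1 a2 r) (derive1 (derive1 a1) r)
  (derive1 (derive1 a2) r).
clear => ? ? ? ? ? ? ? ? ? ? ? ? ? ? rn0.
by field.
Qed.

End Waves.

Section Modes.
Context {R : realType}.
Variables (n : nat) (lam : R) (f beta : R -> R) (Psi : field R).
Hypothesis sf : smooth_pos f.
Hypothesis hPsi : polar_form Psi (vortex_polar n f beta).
Variables (kk : R) (C S : R -> R).
Hypothesis wC : wave kk C (fun th => - kk * S th).
Hypothesis wS : wave kk S (fun th => kk * C th).

Definition mode_polar (A B U W : R -> R) : field R := Field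
  (fun r th => A r * (S th * cos th) + B r * (C th * - sin th))
  (fun r th => A r * (S th * sin th) + B r * (C th * cos th))
  (fun r th => U r * (C th * cos (n%:R * th)) + W r * (S th * - sin (n%:R * th)))
  (fun r th => U r * (C th * sin (n%:R * th)) + W r * (S th * cos (n%:R * th))).

(* Radial and azimuthal vector components, and scalar components in the frame
   rotated by [n * th], of [Hplus xi - om2 xi]; the angular factors are
   [S], [C], [C], [S] respectively. *)
Definition res_rad om2 (A B W : R -> R) (r : R) : R :=
  - (derive1 (derive1 A) r + derive1 A r / r - (kk ^+ 2 + 1) / r ^+ 2 * A r
     + 2 * kk / r ^+ 2 * B r)
  + f r ^+ 2 * A r + 2 * derive1 f r * W r - om2 * A r.

Definition res_ang om2 (A B U : R -> R) (r : R) : R :=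
  - (derive1 (derive1 B) r + derive1 B r / r - (kk ^+ 2 + 1) / r ^+ 2 * B r
     + 2 * kk / r ^+ 2 * A r)
  + f r ^+ 2 * B r - 2 * n%:R * (1 - beta r) * f r / r * U r - om2 * B r.

Definition res_mod om2 (B U W : R -> R) (r : R) : R :=
  - (derive1 (derive1 U) r + derive1 U r / r - kk ^+ 2 / r ^+ 2 * U r)
  + (n%:R ^+ 2 * (1 - beta r) ^+ 2 / r ^+ 2 + 3 * lam / 2 * f r ^+ 2 - lam / 2) * U r
  + 2 * n%:R * (1 - beta r) * kk / r ^+ 2 * W r
  - 2 * n%:R * (1 - beta r) * f r / r * B r - om2 * U r.

Definition res_arg om2 (A U W : R -> R) (r : R) : R :=
  - (derive1 (derive1 W) r + derive1 W r / r - kk ^+ 2 / r ^+ 2 * W r)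
  + (n%:R ^+ 2 * (1 - beta r) ^+ 2 / r ^+ 2
     + f r ^+ 2 + lam / 2 * f r ^+ 2 - lam / 2) * W r
  + 2 * n%:R * (1 - beta r) * kk / r ^+ 2 * U r + 2 * derive1 f r * A r - om2 * W r.

Definition res_gauge (A B W : R -> R) (r : R) : R :=
  derive1 A r + A r / r - kk / r * B r - f r * W r.

Section Mode.
Variables (A B U W : R -> R) (xi : field R).
Hypotheses (sA : smooth_pos A) (sB : smooth_pos B).
Hypotheses (sU : smooth_pos U) (sW : smooth_pos W).
Hypothesis hxi : polar_form xi (mode_polar A B U W).

Lemma Hplus_mode (r th : R) : 0 < r ->
  let c := cos th in let s := sin th in
  let cn := cos (n%:R * th) in let sn := sin (n%:R * th) in
  let x := r * c in let y := r * s in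
  forall om2,
  [/\ vec1 (Hplus lam Psi xi) x y - om2 * vec1 xi x y =
        c * (S th * res_rad om2 A B W r) - s * (C th * res_ang om2 A B U r),
      vec2 (Hplus lam Psi xi) x y - om2 * vec2 xi x y =
        s * (S th * res_rad om2 A B W r) + c * (C th * res_ang om2 A B U r),
      sca1 (Hplus lam Psi xi) x y - om2 * sca1 xi x y =
        cn * (C th * res_mod om2 B U W r) - sn * (S th * res_arg om2 A U W r)
    & sca2 (Hplus lam Psi xi) x y - om2 * sca2 xi x y =
        sn * (C th * res_mod om2 B U W r) + cn * (S th * res_arg om2 A U W r)] /\
  partial1 (vec1 xi) x y + partial2 (vec2 xi) x y
    - (sca1 Psi x y * sca2 xi x y - sca2 Psi x y * sca1 xi x y) =
  S th * res_gauge A B W r.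
Proof.
move=> r0 c s cn sn x y om2.
have rn0 : r != 0 by rewrite gt_eqF.
have [V1 V2 p1 p2] := hPsi th r0.
have [X1 X2 X3 X4] := hxi th r0.
have rep1 : polar_rep (sca1 Psi) (fun r th => f r * cos (n%:R * th)).
  by move=> t p t0; case: (hPsi p t0).
have rep2 : polar_rep (sca2 Psi) (fun r th => f r * sin (n%:R * th)).
  by move=> t p t0; case: (hPsi p t0).
have df (t : R) : 0 < t -> is_derive t 1 f (derive1 f t) by exact: smooth_is_derive.
have dp1 := polar_diff_separable df (@is_derive_cos_mul R n%:R).
have dp2 := polar_diff_separable df (@is_derive_sin_mul R n%:R).
have P11 := partial1_polar rep1 dp1 th r0.
have P12 := partial1_polar rep2 dp2 th r0.
have P21 := partial2_polar rep1 dp1 th r0.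
have P22 := partial2_polar rep2 dp2 th r0.
have h1 : polar_rep (vec1 xi) (vec1 (mode_polar A B U W)).
  by move=> t p t0; case: (hxi p t0).
have h2 : polar_rep (vec2 xi) (vec2 (mode_polar A B U W)).
  by move=> t p t0; case: (hxi p t0).
have h3 : polar_rep (sca1 xi) (sca1 (mode_polar A B U W)).
  by move=> t p t0; case: (hxi p t0).
have h4 : polar_rep (sca2 xi) (sca2 (mode_polar A B U W)).
  by move=> t p t0; case: (hxi p t0).
have [D11 _ L1] := wave_calculus sA wS wave1_cos sB wC (wave_opp wave1_sin) h1 th r0.
have [_ D22 L2] := wave_calculus sA wS wave1_sin sB wC wave1_cos h2 th r0.
have [D31 D32 L3] := wave_calculus sU wC (wave_cos n%:R) sW wS
  (wave_opp (wave_sin n%:R)) h3 th r0.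
have [D41 D42 L4] := wave_calculus sU wC (wave_sin n%:R) sW wS
  (wave_cos n%:R) h4 th r0.
have cs : cos th ^+ 2 = 1 - sin th ^+ 2 := cos2sin2 th.
have csn : cos (n%:R * th) ^+ 2 = 1 - sin (n%:R * th) ^+ 2 := cos2sin2 _.
rewrite /x /y /c /s /Hplus /= /psi_sq /V_sq /V_grad.
rewrite /covD1_psi1 /covD1_psi2 /covD2_psi1 /covD2_psi2.
rewrite V1 V2 p1 p2 X1 X2 X3 X4 P11 P12 P21 P22 L1 L2 L3 L4.
rewrite D11 D22 D31 D32 D41 D42 /=.
rewrite /res_rad /res_ang /res_mod /res_arg /res_gauge -/cn -/sn.
move: cs csn; rewrite -/c -/s -/cn -/sn.
clear x y V1 V2 p1 p2 X1 X2 X3 X4 P11 P12 P21 P22 L1 L2 L3 L4 D11 D22 D31 D32 D41 D42.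
clearbody c s cn sn.
move: c s cn sn (C th) (S th) (A r) (B r) (U r) (W r) (f r) (beta r).
move: (derive1 A r) (derive1 B r) (derive1 U r) (derive1 W r) (derive1 f r).
move: (derive1 (derive1 A) r) (derive1 (derive1 B) r) (derive1 (derive1 U) r)
  (derive1 (derive1 W) r) (n%:R : R).
clear -rn0 => A2 B2 U2 W2 N A1 B1 U1 W1 f1 c s cn sn C0 S0 A0 B0 U0 W0 f0 b0 cs csn.
split; last by field: cs csn.
split; by field: cs csn.
Qed.

Lemma eigen_eq_mode om2 : eigen_eq lam Psi om2 xi <->
  forall r th, 0 < r ->
    [/\ S th * res_rad om2 A B W r = 0, C th * res_ang om2 A B U r = 0,
        C th * res_mod om2 B U W r = 0 & S th * res_arg om2 A U W r = 0].
Proof.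
split=> [/polar_forall H r th r0|H].
  have eq0 (a b c : R) : a = b -> a - b = c -> c = 0 by move=> -> <-; exact: subrr.
  have [h1 h2 h3 h4] := H r th r0.
  have [[m1 m2 m3 m4] _] := Hplus_mode th r0 om2.
  have e1 := eq0 _ _ _ h1 m1; have e2 := eq0 _ _ _ h2 m2.
  have e3 := eq0 _ _ _ h3 m3; have e4 := eq0 _ _ _ h4 m4.
  have cs := cos2sin2 th; have csn := cos2sin2 (n%:R * th).
  split.
  - transitivity (cos th * 0 + sin th * 0 : R); last by ring.
    by rewrite -{1}e1 -e2; ring: cs.
  - transitivity (- sin th * 0 + cos th * 0 : R); last by ring.
    by rewrite -{1}e1 -e2; ring: cs.
  - transitivity (cos (n%:R * th) * 0 + sin (n%:R * th) * 0 : R); last by ring.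
    by rewrite -{1}e3 -e4; ring: csn.
  - transitivity (- sin (n%:R * th) * 0 + cos (n%:R * th) * 0 : R); last by ring.
    by rewrite -{1}e3 -e4; ring: csn.
apply/polar_forall => r th r0.
have [h1 h2 h3 h4] := H r th r0.
have [[m1 m2 m3 m4] _] := Hplus_mode th r0 om2.
have eq (a b c : R) : a - b = c -> c = 0 -> a = b.
  by move=> <- /eqP; rewrite subr_eq0 => /eqP.
by split; [apply: eq m1 _|apply: eq m2 _|apply: eq m3 _|apply: eq m4 _];
  rewrite ?h1 ?h2 ?h3 ?h4 !mulr0 ?subr0 ?addr0.
Qed.

Lemma background_gauge_mode : background_gauge Psi xi <->
  forall r th, 0 < r -> S th * res_gauge A B W r = 0.
Proof.
split=> [/polar_forall H r th r0|H].
  by have [_ <-] := Hplus_mode th r0 0; exact: H.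
by apply/polar_forall => r th r0; have [_ ->] := Hplus_mode th r0 0; exact: H.
Qed.

End Mode.

Section Multipolar.
Hypothesis f_ode : forall r, 0 < r ->
  derive1 (derive1 f) r + r^-1 * derive1 f r
    - n%:R ^+ 2 / r ^+ 2 * (1 - beta r) ^+ 2 * f r
    + lam / 2 * (1 - f r ^+ 2) * f r = 0.
Hypothesis kk0 : kk != 0.
Hypotheses (C0 : exists th, C th != 0) (S0 : exists th, S th != 0).

Definition rad_of (v : R -> R) (r : R) : R := - kk * (v r * r^-1).
Definition ang_of (v w : R -> R) (r : R) : R :=
  - derive1 v r + (r * f r) * w r.
Definition arg_of (w : R -> R) (r : R) : R := - kk * w r.

Definition eqn_v om2 (v w : R -> R) (r : R) : R :=
  - (derive1 (derive1 v) r) - derive1 v r * r^-1 + kk ^+ 2 * (v r * (r^-1 * r^-1))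
  + (f r * f r) * v r + 2 * ((f r + r * derive1 f r) * w r) - om2 * v r.

Definition eqn_u om2 (v u w : R -> R) (r : R) : R :=
  2 * n%:R * (1 - beta r) * f r / r * derive1 v r
  + (- derive1 (derive1 u) r - derive1 u r / r + kk ^+ 2 / r ^+ 2 * u r
     + (n%:R ^+ 2 * (1 - beta r) ^+ 2 / r ^+ 2
        + 3 * lam / 2 * f r ^+ 2 - lam / 2) * u r)
  - 2 * n%:R * (1 - beta r) * (kk ^+ 2 + r ^+ 2 * f r ^+ 2) / r ^+ 2 * w r
  - om2 * u r.

Definition eqn_w om2 (v u w : R -> R) (r : R) : R :=
  2 * derive1 f r / r * v r - 2 * n%:R * (1 - beta r) / r ^+ 2 * u r
  + (- derive1 (derive1 w) r - derive1 w r / r + kk ^+ 2 / r ^+ 2 * w r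
     + (n%:R ^+ 2 * (1 - beta r) ^+ 2 / r ^+ 2
        + f r ^+ 2 + lam / 2 * f r ^+ 2 - lam / 2) * w r)
  - om2 * w r.

Section Substitution.
Variables (v u w : R -> R).
Hypotheses (sv : smooth_pos v) (sw : smooth_pos w).

Lemma smooth_rad_of : smooth_pos (rad_of v).
Proof.
apply/smooth_genP/gen_mul; first exact: gen_const.
by apply: gen_mul; [exact: gen_smooth|exact: gen_inv].
Qed.

Lemma smooth_ang_of : smooth_pos (ang_of v w).
Proof.
have s1 : smooth_pos (fun r => -1 * derive1 v r + (r * f r) * w r).
  apply/smooth_genP/gen_add; apply: gen_mul; try exact: gen_const.
  - exact/gen_smooth/smooth_derive1.
  - by apply: gen_mul; [exact: gen_ident|exact: gen_smooth].
  - exact: gen_smooth.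
by apply: smooth_eq s1 => r; rewrite /ang_of mulN1r.
Qed.

Lemma smooth_arg_of : smooth_pos (arg_of w).
Proof.
by apply/smooth_genP/gen_mul; [exact: gen_const|exact: gen_smooth].
Qed.

Lemma derive1_rad_of r : 0 < r ->
  derive1 (rad_of v) r = - kk * (derive1 v r / r - v r / r ^+ 2) /\
  derive1 (derive1 (rad_of v)) r = - kk *
    (derive1 (derive1 v) r / r - 2 * derive1 v r / r ^+ 2 + 2 * v r / r ^+ 3).
Proof.
have d1 (t : R) : 0 < t -> is_derive t 1 (rad_of v)
    (- kk * (derive1 v t * t^-1 + - (v t * (t^-1 * t^-1)))).
  move=> t0; have dv := smooth_is_derive sv t0; have t1 := gt_eqF t0.
  apply: is_derive_eq (is_derive_scale (- kk)
    (is_derive_mul dv (is_derive_invr t0))) _.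
  move: (derive1 v t) (v t) => v1 v0.
  by field; rewrite t1.
move=> r0; split.
  rewrite (is_derive_derive1 (d1 _ r0)); have r1 := gt_eqF r0.
  move: (derive1 v r) (v r) => v1 v0.
  by field; rewrite r1.
rewrite (derive1_pos_eq r0 (fun t t0 => is_derive_derive1 (d1 t t0))).
have dv := smooth_is_derive sv r0; have r1 := gt_eqF r0.
have dv1 := smooth_is_derive (smooth_derive1 sv) r0.
have di := is_derive_invr r0.
apply: is_derive_derive1; apply: is_derive_eq (is_derive_scale (- kk)
  (is_derive_add (is_derive_mul dv1 di)
    (is_derive_opp (is_derive_mul dv (is_derive_mul di di))))) _.
move: (derive1 (derive1 v) r) (derive1 v r) (v r) => v2 v1 v0.
by field; rewrite r1.
Qed.

Lemma derive1_ang_of r : 0 < r ->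
  derive1 (ang_of v w) r =
    - derive1 (derive1 v) r
    + (f r + r * derive1 f r) * w r + r * f r * derive1 w r /\
  derive1 (derive1 (ang_of v w)) r =
    - derive1 (derive1 (derive1 v)) r
    + (2 * derive1 f r + r * derive1 (derive1 f) r) * w r
    + 2 * (f r + r * derive1 f r) * derive1 w r
    + r * f r * derive1 (derive1 w) r.
Proof.
have d1 (t : R) : 0 < t -> is_derive t 1 (ang_of v w) (- derive1 (derive1 v) t
    + (f t + t * derive1 f t) * w t + t * f t * derive1 w t).
  move=> t0; have dv := smooth_is_derive (smooth_derive1 sv) t0.
  have dw := smooth_is_derive sw t0; have df := smooth_is_derive sf t0.
  apply: is_derive_eq (is_derive_add (is_derive_opp dv)
    (is_derive_mul (is_derive_mul (is_derive_ident t) df) dw)) _.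
  move: (derive1 (derive1 v) t) (derive1 f t) (f t) (derive1 w t) (w t) => v2 f1 f0 w1 w0.
  by ring.
move=> r0; split; first exact: is_derive_derive1 (d1 _ r0).
rewrite (derive1_pos_eq r0 (fun t t0 => is_derive_derive1 (d1 t t0))).
have dv := smooth_is_derive (smooth_derive1 (smooth_derive1 sv)) r0.
have dw := smooth_is_derive sw r0; have df := smooth_is_derive sf r0.
have dw1 := smooth_is_derive (smooth_derive1 sw) r0.
have df1 := smooth_is_derive (smooth_derive1 sf) r0.
apply: is_derive_derive1; apply: is_derive_eq (is_derive_add (is_derive_add
  (is_derive_opp dv)
  (is_derive_mul (is_derive_add df (is_derive_mul (is_derive_ident r) df1)) dw))
  (is_derive_mul (is_derive_mul (is_derive_ident r) df) dw1)) _.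
move: (derive1 (derive1 (derive1 v)) r) (derive1 (derive1 f) r) (derive1 f r) (f r).
move: (derive1 (derive1 w) r) (derive1 w r) (w r) => w2 w1 w0 v3 f2 f1 f0.
by ring.
Qed.

Lemma derive1_arg_of r : 0 < r ->
  derive1 (arg_of w) r = - kk * derive1 w r /\
  derive1 (derive1 (arg_of w)) r = - kk * derive1 (derive1 w) r.
Proof.
have d1 (t : R) : 0 < t -> is_derive t 1 (arg_of w) (- kk * derive1 w t).
  move=> t0; have dw := smooth_is_derive sw t0.
  exact: (is_derive_scale (- kk) dw).
move=> r0; split; first exact: is_derive_derive1 (d1 _ r0).
rewrite (derive1_pos_eq r0 (fun t t0 => is_derive_derive1 (d1 t t0))).
have dw1 := smooth_is_derive (smooth_derive1 sw) r0.
exact: is_derive_derive1 (is_derive_scale (- kk) dw1).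
Qed.

Lemma derive1_eqn_v om2 r : 0 < r ->
  derive1 (eqn_v om2 v w) r =
    - derive1 (derive1 (derive1 v)) r - derive1 (derive1 v) r / r
    + derive1 v r / r ^+ 2 + kk ^+ 2 * (derive1 v r / r ^+ 2 - 2 * v r / r ^+ 3)
    + 2 * f r * derive1 f r * v r + f r ^+ 2 * derive1 v r
    + 2 * ((2 * derive1 f r + r * derive1 (derive1 f) r) * w r
           + (f r + r * derive1 f r) * derive1 w r) - om2 * derive1 v r.
Proof.
move=> r0; have r1 := gt_eqF r0.
have dv := smooth_is_derive sv r0; have dv1 := smooth_is_derive (smooth_derive1 sv) r0.
have dv2 := smooth_is_derive (smooth_derive1 (smooth_derive1 sv)) r0.
have dw := smooth_is_derive sw r0; have df := smooth_is_derive sf r0.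
have df1 := smooth_is_derive (smooth_derive1 sf) r0.
have di := is_derive_invr r0.
apply: is_derive_derive1; apply: is_derive_eq (is_derive_add (is_derive_add
  (is_derive_add (is_derive_add (is_derive_add (is_derive_opp dv2)
    (is_derive_opp (is_derive_mul dv1 di)))
    (is_derive_scale (kk ^+ 2) (is_derive_mul dv (is_derive_mul di di))))
    (is_derive_mul (is_derive_mul df df) dv))
    (is_derive_scale 2
      (is_derive_mul (is_derive_add df (is_derive_mul (is_derive_ident r) df1)) dw)))
    (is_derive_opp (is_derive_scale om2 dv))) _.
move: (derive1 (derive1 (derive1 v)) r) (derive1 (derive1 v) r) (derive1 v r) (v r).
move: (derive1 (derive1 f) r) (derive1 f r) (f r) (derive1 w r) (w r).
move=> f2 f1 f0 w1 w0 v3 v2 v1 v0.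
by field; rewrite r1.
Qed.

(* The second vector equation is redundant: it is the derivative of the first
   one corrected by a multiple of the third, thanks to the profile equation
   for [f]. *)
Lemma multipolar_residuals om2 r : 0 < r ->
  [/\ res_rad om2 (rad_of v) (ang_of v w) (arg_of w) r =
        - (kk / r) * eqn_v om2 v w r,
      res_ang om2 (rad_of v) (ang_of v w) u r =
        - derive1 (eqn_v om2 v w) r + r * f r * eqn_w om2 v u w r,
      res_mod om2 (ang_of v w) u (arg_of w) r = eqn_u om2 v u w r,
      res_arg om2 (rad_of v) u (arg_of w) r = - kk * eqn_w om2 v u w r
    & res_gauge (rad_of v) (ang_of v w) (arg_of w) r = 0].
Proof.
move=> r0; have := gt_eqF r0; have := f_ode r0.
rewrite /res_rad /res_ang /res_mod /res_arg /res_gauge (derive1_eqn_v om2 r0).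
have [-> ->] := derive1_rad_of r0.
have [-> ->] := derive1_ang_of r0.
have [-> ->] := derive1_arg_of r0.
rewrite /rad_of /ang_of /arg_of /eqn_v /eqn_u /eqn_w.
move: (derive1 (derive1 f) r) (derive1 f r) (f r) (beta r) (n%:R : R).
move: (derive1 (derive1 (derive1 v)) r) (derive1 (derive1 v) r) (derive1 v r) (v r).
move: (derive1 (derive1 u) r) (derive1 u r) (u r).
move: (derive1 (derive1 w) r) (derive1 w r) (w r).
move=> w2 w1 w0 u2 u1 u0 v3 v2 v1 v0 f2 f1 f0 b0 N fe r1.
have {}fe : f2 = - (r^-1 * f1 - N ^+ 2 / r ^+ 2 * (1 - b0) ^+ 2 * f0
    + lam / 2 * (1 - f0 ^+ 2) * f0).
  by apply/eqP; rewrite -subr_eq0 opprK -fe; apply/eqP; ring.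
by split; rewrite ?fe; field; rewrite r1.
Qed.

End Substitution.

Lemma multipolar_equiv om2 v u w xi :
  smooth_pos v -> smooth_pos u -> smooth_pos w ->
  polar_form xi (mode_polar (rad_of v) (ang_of v w) u (arg_of w)) ->
  background_gauge Psi xi /\ eigen_eq lam Psi om2 xi <->
  forall r, 0 < r ->
    [/\ eqn_v om2 v w r = 0, eqn_u om2 v u w r = 0 & eqn_w om2 v u w r = 0].
Proof.
move=> sv su sw hxi.
have sA := smooth_rad_of sv; have sB := smooth_ang_of sv sw.
have sW := smooth_arg_of sw.
have mul0 (x y : R) : x != 0 -> x * y = 0 -> y = 0.
  by move=> x0 /eqP; rewrite mulf_eq0 (negbTE x0) => /eqP.
split=> [[_ /(eigen_eq_mode sA sB su sW hxi) H] r r0|H].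
  have [c Cc] := C0; have [s Ss] := S0.
  have [/(mul0 _ _ Ss) h1 _ _ /(mul0 _ _ Ss) h4] := H r s r0.
  have [_ _ /(mul0 _ _ Cc) h3 _] := H r c r0.
  have [e1 e2 e3 e4 _] := multipolar_residuals u sv sw om2 r0.
  split; last 2 first.
  - by rewrite -e3.
  - by apply: (mul0 (- kk)); rewrite ?oppr_eq0// -e4.
  - apply: (mul0 (- (kk / r))); last by rewrite -e1.
    by rewrite oppr_eq0 mulf_neq0// invr_neq0// gt_eqF.
split.
  apply/(background_gauge_mode sA sB su sW hxi) => r th r0.
  by have [_ _ _ _ ->] := multipolar_residuals u sv sw 0 r0; rewrite mulr0.
apply/(eigen_eq_mode sA sB su sW hxi) => r th r0.
have [-> -> -> ->] := multipolar_residuals u sv sw om2 r0.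
have [-> -> ->] := H r r0.
have -> : derive1 (eqn_v om2 v w) r = 0.
  rewrite (@derive1_pos_eq _ _ (fun=> 0) _ r0); last by move=> t /H[].
  exact: is_derive_derive1 (is_derive_const 0 r).
by rewrite !mulr0 oppr0 addr0 mulr0.
Qed.

End Multipolar.
End Modes.

Section Orthogonality.
Context {R : realType}.
Let mu := @lebesgue_measure R.
Local Open Scope ereal_scope.

Lemma lebesgue_measure_opp (A : set (measurableTypeR R)) : measurable A ->
  mu A = pushforward mu (-%R : measurableTypeR R -> measurableTypeR R) A.
Proof.
apply: lebesgue_measure_unique => _ [[a b] _ <-] /=.
rewrite /pushforward.
have -> : (-%R : R -> R) @^-1` `]a, b] = `[(- b)%R, (- a)%R[%classic.
  by apply/seteqP; split => x /=; rewrite !in_itv/= lerNl ltrNr andbC.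
rewrite !lebesgue_measure_itv/= !lte_fin ltrN2; case: ifP => // _.
by rewrite -!EFinB opprK addrC.
Qed.

Lemma integral_odd (h : R -> \bar R) : mu.-integrable setT h ->
  (forall y, h (- y)%R = - h y) -> \int[mu]_y h y = 0.
Proof.
move=> ih hodd.
have mh := measurable_int mu ih.
have mN : measurable_fun setT (-%R : measurableTypeR R -> measurableTypeR R).
  exact: oppr_measurable.
have ihN : mu.-integrable setT (h \o -%R).
  apply: (eq_integrable _ _ _ _ (integrableN ih)) => // y _ /=.
  by rewrite hodd.
have E : \int[mu]_y h y = \int[mu]_y h (- y)%R.
  transitivity (\int[pushforward mu (-%R : measurableTypeR R -> measurableTypeR R)]_y h y).
    by apply: eq_measure_integral => A mA _; exact: lebesgue_measure_opp.
  by rewrite (integral_pushforward mN mh ihN).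
have : \int[mu]_y h y = - \int[mu]_y h y.
  rewrite {1}E -integralN; last exact: integrable_add_def.
  by apply: eq_integral => y _; exact: hodd.
have /fineK <- : \int[mu]_y h y \is a fin_num by exact: integrable_fin_num.
by rewrite -EFinN => -[] H; congr EFin; lra.
Qed.

Lemma plane_integral_odd (p : R -> R -> R) :
  (forall x y, (x, y) != (0, 0)%R -> p x (- y)%R = (- p x y)%R) ->
  (@plane_measure R).-integrable setT (fun z => (p z.1 z.2)%:E) ->
  \int[@plane_measure R]_z (p z.1 z.2)%:E = 0.
Proof.
move=> podd ip.
rewrite /plane_measure -(integral12_prod_meas1 ip).
have mF := measurable_fubini_F ip.
rewrite (ae_eq_integral (cst 0) _ measurableT mF) ?integral0//.
have n0 : {ae @lebesgue_measure R, forall x, x != 0%R}.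
  exists [set 0%R]; split => //; first exact: lebesgue_measure_set1.
  by move=> x /= /negP; rewrite negbK => /eqP.
have ii := ae_integrable1 ip.
have FF := ae_filter_ringOfSetsType (@lebesgue_measure R).
apply: filterS2 n0 ii => x x0 ix _ /=.
rewrite /fubini_F; apply: integral_odd => // y.
by rewrite podd// xpair_eqE negb_and x0.
Qed.

Lemma integral_cos_sin (c : R) (k : nat) : (1 <= k)%N ->
  \int[mu]_(th in `[0%R, (2 * pi)%R])
    (c * (cos (k%:R * th) * sin (k%:R * th)))%:E = 0.
Proof.
move=> k1; have k0 : (k%:R : R) != 0%R by rewrite pnatr_eq0 -lt0n.
pose F (th : R) := (c / (2 * k%:R) * (sin (k%:R * th) * sin (k%:R * th)))%R.
have dF (th : R) : is_derive th 1%R F (c * (cos (k%:R * th) * sin (k%:R * th)))%R.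
  have ds := is_derive_sin_mul (k%:R : R) th.
  apply: is_derive_eq (is_derive_scale _ (is_derive_mul ds ds)) _.
  by move: (cos _) (sin _) => a b; field; rewrite k0.
have cF : continuous F.
  by move=> th; exact: is_derive_continuous (dF th).
have cf : continuous (fun th : R => c * (cos (k%:R * th) * sin (k%:R * th)))%R.
  move=> th; apply: (@is_derive_continuous R _ _ _ (is_derive_scale c (is_derive_mul
    (is_derive_cos_mul (k%:R : R) th) (is_derive_sin_mul (k%:R : R) th)))).
rewrite (@continuous_FTC2 _ _ F).
- have s0 : sin (k%:R * (2 * pi)) = 0%R :> R.
    have := periodicn (@sinD2pi R) k 0; rewrite add0r sin0 => <-; congr sin.
    by rewrite !mulr_natl.
  by rewrite /F s0 !mulr0 sin0 !mulr0 subee.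
- by rewrite mulr_gt0// pi_gt0.
- exact: continuous_subspaceT.
- split=> [th _||].
  + exact: (@ex_derive _ _ _ _ _ _ _ (dF th)).
  + exact/cvg_at_right_filter/cF.
  + exact/cvg_at_left_filter/cF.
- by move=> th _; rewrite (is_derive_derive1 (dF th)).
Qed.

End Orthogonality.

Section PolarFields.
Context {R : realType}.
Implicit Types (xi F G : field R) (r th : R).

Lemma polar_form_eq xi F G :
  (forall r th, 0 < r -> [/\ vec1 F r th = vec1 G r th, vec2 F r th = vec2 G r th,
     sca1 F r th = sca1 G r th & sca2 F r th = sca2 G r th]) ->
  polar_form xi F -> polar_form xi G.
Proof.
move=> FG hF r th r0.
by have [<- <- <- <-] := FG r th r0; exact: hF.
Qed.

Definition single_valued (h : R -> R -> R) :=
  forall r th th', cos th = cos th' -> sin th = sin th' -> h r th = h r th'.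

Lemma polar_rep_exists h : single_valued h -> exists H, polar_rep H h.
Proof.
move=> sv; pose rho (x y : R) : R := Num.sqrt (x ^+ 2 + y ^+ 2).
pose tau x y := xget 0 [set th | x = rho x y * cos th /\ y = rho x y * sin th].
exists (fun x y => h (rho x y) (tau x y)) => r th r0.
have rn0 : r != 0 by rewrite gt_eqF.
have rhoE : rho (r * cos th) (r * sin th) = r.
  rewrite /rho !exprMn -mulrDr cos2Dsin2 mulr1 sqrtr_sqr.
  exact: gtr0_norm.
rewrite rhoE; have [] : [set t | r * cos th = rho (r * cos th) (r * sin th) * cos t /\
    r * sin th = rho (r * cos th) (r * sin th) * sin t]
    (tau (r * cos th) (r * sin th)).
  by apply: (@xgetPex _ 0); exists th => /=; rewrite rhoE.
rewrite rhoE => /(mulfI rn0) c /(mulfI rn0) s.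
by apply/esym/sv.
Qed.

Lemma polar_field_exists F : single_valued (vec1 F) -> single_valued (vec2 F) ->
  single_valued (sca1 F) -> single_valued (sca2 F) -> exists xi, polar_form xi F.
Proof.
move=> /polar_rep_exists[h1 H1] /polar_rep_exists[h2 H2].
move=> /polar_rep_exists[h3 H3] /polar_rep_exists[h4 H4].
by exists (Field h1 h2 h3 h4) => r th r0; split; [exact: H1|exact: H2|exact: H3|exact: H4].
Qed.

Lemma cos_sin_natmul_eq (th th' : R) : cos th = cos th' -> sin th = sin th' ->
  forall m : nat, cos (m%:R * th) = cos (m%:R * th') /\ sin (m%:R * th) = sin (m%:R * th').
Proof.
move=> c s; elim=> [|m [IHc IHs]]; first by rewrite !mul0r.
by rewrite -[m.+1]addn1 !natrD !mulrDl !mul1r !cosD !sinD c s IHc IHs.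
Qed.

Lemma wave_sin_opp_cos (k : R) :
  wave k (fun th => sin (k * th)) (fun th => - k * - cos (k * th)) /\
  wave k (fun th => - cos (k * th)) (fun th => k * sin (k * th)).
Proof.
split; first by under [X in wave _ _ X]eq_fun do rewrite mulrNN; exact: wave_sin.
have := wave_opp (wave_cos k).
by under [X in wave _ _ X -> _]eq_fun do rewrite -mulNr opprK.
Qed.

Lemma cos_natmul_neq0 (k : nat) : exists th : R, cos (k%:R * th) != 0.
Proof. by exists 0; rewrite mulr0 cos0 oner_eq0. Qed.

Lemma sin_natmul_neq0 (k : nat) : (1 <= k)%N -> exists th : R, sin (k%:R * th) != 0.
Proof.
move=> k1; exists (pi / 2 / k%:R); rewrite mulrCA divff ?pnatr_eq0 -?lt0n//.
by rewrite mulr1 sin_pihalf oner_eq0.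
Qed.

End PolarFields.

Section Vortex.
Context {R : realType}.
Variables (n : nat) (lam : R) (f beta : R -> R) (Psi : field R).
Hypothesis hprof : vortex_profiles n lam f beta.
Hypothesis hPsi : polar_form Psi (vortex_polar n f beta).

Let sf : smooth_pos f := f_smooth hprof.

Lemma vortex_ode (r : R) : 0 < r -> derive1 (derive1 f) r + r^-1 * derive1 f r
    - n%:R ^+ 2 / r ^+ 2 * (1 - beta r) ^+ 2 * f r
    + lam / 2 * (1 - f r ^+ 2) * f r = 0.
Proof. exact: f_eq hprof r. Qed.

Lemma multipolar_mode (k : nat) (C S v u w : R -> R) xi :
  polar_form xi (multipolar_form n k f C S v u w) <->
  polar_form xi (mode_polar n C S (rad_of k%:R v) (ang_of f v w) u (arg_of k%:R w)).
Proof.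
by split; apply: polar_form_eq => r th r0; rewrite /rad_of /ang_of /arg_of /=;
  move: (derive1 v r) (v r) (u r) (w r) (f r) (C th) (S th) (cos th) (sin th)
    (cos (n%:R * th)) (sin (n%:R * th)) (k%:R : R) => v1 v0 u0 w0 f0 C0 S0 c s cn sn K;
  split; ring.
Qed.

Lemma Hbar_eqn (k : nat) om2 v u w : Hbar_eq n k lam f beta om2 v u w <->
  forall r, 0 < r ->
    [/\ eqn_v f k%:R om2 v w r = 0, eqn_u n lam f beta k%:R om2 v u w r = 0
      & eqn_w n lam f beta k%:R om2 v u w r = 0].
Proof.
have eq0 (a b c : R) : c = a - b -> a = b <-> c = 0.
  move=> ->; split=> [->|/eqP]; first exact: subrr.
  by rewrite subr_eq0 => /eqP.
have e1 r : 0 < r -> Lradial k v r + f r ^+ 2 * v r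
        + 2 * (f r + r * derive1 f r) * w r = om2 * v r
    <-> eqn_v f k%:R om2 v w r = 0.
  move=> r0; apply: eq0; have := gt_eqF r0; rewrite /eqn_v /Lradial /derive1n /=.
  move: (derive1 (derive1 v) r) (derive1 v r) (v r) (derive1 f r) (f r) (w r).
  by move=> v2 v1 v0 f1 f0 w0 rn0; field; rewrite rn0.
have e2 r : 0 < r -> 2 * n%:R * (1 - beta r) * f r / r * derive1 v r
        + (Lradial k u r
           + (n%:R ^+ 2 * (1 - beta r) ^+ 2 / r ^+ 2
              + 3 * lam / 2 * f r ^+ 2 - lam / 2) * u r)
        - 2 * n%:R * (1 - beta r) * (k%:R ^+ 2 + r ^+ 2 * f r ^+ 2) / r ^+ 2
          * w r = om2 * u r
    <-> eqn_u n lam f beta k%:R om2 v u w r = 0.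
  move=> r0; apply: eq0; have := gt_eqF r0; rewrite /eqn_u /Lradial /derive1n /=.
  move: (derive1 (derive1 u) r) (derive1 u r) (u r) (derive1 v r) (f r) (w r) (beta r).
  by move=> u2 u1 u0 v1 f0 w0 b0 rn0; field; rewrite rn0.
have e3 r : 0 < r -> 2 * derive1 f r / r * v r
        - 2 * n%:R * (1 - beta r) / r ^+ 2 * u r
        + (Lradial k w r
           + (n%:R ^+ 2 * (1 - beta r) ^+ 2 / r ^+ 2
              + f r ^+ 2 + lam / 2 * f r ^+ 2 - lam / 2) * w r) = om2 * w r
    <-> eqn_w n lam f beta k%:R om2 v u w r = 0.
  move=> r0; apply: eq0; have := gt_eqF r0; rewrite /eqn_w /Lradial /derive1n /=.
  move: (derive1 (derive1 w) r) (derive1 w r) (w r) (derive1 f r) (f r) (v r) (u r) (beta r).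
  by move=> w2 w1 w0 f1 f0 v0 u0 b0 rn0; field; rewrite rn0.
split=> H r r0; have [h1 h2 h3] := H r r0.
  by split; [exact/e1|exact/e2|exact/e3].
by split; [exact/(e1 r r0)|exact/(e2 r r0)|exact/(e3 r r0)].
Qed.

Section MultipolarModes.
Variables (k : nat).
Hypothesis k1 : (1 <= k)%N.

Let kn0 : (k%:R : R) != 0. Proof. by rewrite pnatr_eq0 -lt0n. Qed.

Lemma xi_equiv om2 v u w xi : smooth_pos v -> smooth_pos u -> smooth_pos w ->
  polar_form xi (xi_polar n k f v u w) ->
  background_gauge Psi xi /\ eigen_eq lam Psi om2 xi <->
  Hbar_eq n k lam f beta om2 v u w.
Proof.
move=> sv su sw /multipolar_mode hxi; rewrite Hbar_eqn.
exact: (multipolar_equiv sf hPsi (wave_cos _) (wave_sin _) vortex_ode kn0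
  (cos_natmul_neq0 k) (sin_natmul_neq0 k1) om2 sv su sw hxi).
Qed.

Lemma chi_equiv om2 v u w chi : smooth_pos v -> smooth_pos u -> smooth_pos w ->
  polar_form chi (chi_polar n k f v u w) ->
  background_gauge Psi chi /\ eigen_eq lam Psi om2 chi <->
  Hbar_eq n k lam f beta om2 v u w.
Proof.
move=> sv su sw /multipolar_mode hchi; rewrite Hbar_eqn.
have [wC wS] := @wave_sin_opp_cos R k%:R.
have S0 : exists th : R, - cos (k%:R * th) != 0.
  by have [th c] := @cos_natmul_neq0 R k; exists th; rewrite oppr_eq0.
exact: (multipolar_equiv sf hPsi wC wS vortex_ode kn0 (sin_natmul_neq0 k1) S0
  om2 sv su sw hchi).
Qed.

Lemma admissible_mode xi : admissible n k xi <-> exists A B U W : R -> R,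
  [/\ smooth_pos A, smooth_pos B, smooth_pos U, smooth_pos W &
   polar_form xi (mode_polar n (fun th => cos (k%:R * th)) (fun th => sin (k%:R * th))
     A B U W)].
Proof.
have sD (g h : R -> R) (a b : R) : smooth_pos g -> smooth_pos h ->
    smooth_pos (fun r => a * g r + b * h r).
  move=> sg sh; apply/smooth_genP/gen_add; apply: gen_mul;
    by [exact: gen_const|exact: gen_smooth].
split=> [[g1 [g2 [t1 [t2 [s1 s2 s3 s4 h]]]]]|[A [B [U [W [s1 s2 s3 s4 h]]]]]].
  exists (fun r => 1 * g1 r + -1 * g2 r), (fun r => 1 * g1 r + 1 * g2 r),
    (fun r => 1 * t1 r + 1 * t2 r), (fun r => -1 * t1 r + 1 * t2 r).
  split; try exact: sD.
  apply: polar_form_eq h => r th r0 /=.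
  by rewrite !mulrBl !mulrDl !mul1r !sinB !cosB !sinD !cosD; split; ring.
exists (fun r => 2^-1 * A r + 2^-1 * B r), (fun r => - 2^-1 * A r + 2^-1 * B r),
  (fun r => 2^-1 * U r + - 2^-1 * W r), (fun r => 2^-1 * U r + 2^-1 * W r).
split; try exact: sD.
apply: polar_form_eq h => r th r0 /=.
by rewrite !mulrBl !mulrDl !mul1r !sinB !cosB !sinD !cosD; split; field.
Qed.

(* The gauge condition determines [B] from [A] and [W]: it is solved by the
   potential [v = - r A / k]. *)
Lemma multipolar_of_gauge (A B W : R -> R) : smooth_pos A -> smooth_pos W ->
  (forall r, 0 < r -> res_gauge f k%:R A B W r = 0) ->
  exists v w, [/\ smooth_pos v, smooth_pos w & forall r, 0 < r ->
    [/\ A r = rad_of k%:R v r, B r = ang_of f v w r & W r = arg_of k%:R w r]].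
Proof.
move=> sA sW hg.
exists (fun r => - k%:R^-1 * (r * A r)), (fun r => - k%:R^-1 * W r); split.
- apply/smooth_genP/gen_mul; first exact: gen_const.
  by apply: gen_mul; [exact: gen_ident|exact: gen_smooth].
- by apply/smooth_genP/gen_mul; [exact: gen_const|exact: gen_smooth].
move=> r r0; have rn0 : r != 0 by rewrite gt_eqF.
have dv := is_derive_scale (- k%:R^-1)
  (is_derive_mul (is_derive_ident r) (smooth_is_derive sA r0)).
have := hg r r0; rewrite /res_gauge /rad_of /ang_of /arg_of (is_derive_derive1 dv).
move: (derive1 A r) (A r) (B r) (W r) (f r) (k%:R : R) kn0 => A1 A0 B0 W0 f0 K K0 g.
split.
- by field; rewrite rn0 K0.
- apply/eqP; rewrite -subr_eq0; apply/eqP.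
  transitivity (- (r / K) * 0); last by rewrite mulr0.
  by rewrite -g; field; rewrite rn0 K0.
- by field; rewrite K0.
Qed.

Lemma xi_characterization om2 xi :
  [/\ admissible n k xi, background_gauge Psi xi & eigen_eq lam Psi om2 xi] <->
  exists v u w : R -> R,
    [/\ smooth_pos v, smooth_pos u, smooth_pos w,
        polar_form xi (xi_polar n k f v u w) & Hbar_eq n k lam f beta om2 v u w].
Proof.
split=> [[/admissible_mode[A [B [U [W [sA sB sU sW h]]]]] hg he]|].
  have wC := @wave_cos R k%:R; have wS := @wave_sin R k%:R.
  have [|v [w [sv sw AW]]] := multipolar_of_gauge (B := B) sA sW.
    move=> r r0; have [th s0] := @sin_natmul_neq0 R k k1.
    have /(_ r th r0)/eqP :=
      (background_gauge_mode lam sf hPsi wC wS sA sB sU sW h).1 hg.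
    by rewrite mulf_eq0 (negbTE s0) => /eqP.
  have hxi : polar_form xi (xi_polar n k f v U w).
    apply/multipolar_mode; apply: polar_form_eq h => r th r0 /=.
    by have [-> -> ->] := AW r r0.
  by exists v, U, w; split => //; apply/(xi_equiv om2 sv sU sw hxi).
move=> [v [u [w [sv su sw hxi hH]]]].
have [hg he] := (xi_equiv om2 sv su sw hxi).2 hH.
split=> //; apply/admissible_mode.
exists (rad_of k%:R v), (ang_of f v w), u, (arg_of k%:R w).
split; last exact/multipolar_mode.
- exact: smooth_rad_of.
- exact: smooth_ang_of.
- exact: su.
- exact: smooth_arg_of.
Qed.

Lemma orthogonal_xi_chi v u w v' u' w' xi chi :
  polar_form xi (xi_polar n k f v u w) ->
  polar_form chi (chi_polar n k f v' u' w') -> orthogonal_fields xi chi.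
Proof.
move=> /multipolar_mode hxi /multipolar_mode hchi.
set A := rad_of _ v in hxi; set B := ang_of _ v w in hxi; set W := arg_of _ w in hxi.
set A' := rad_of _ v' in hchi; set B' := ang_of _ v' w' in hchi.
set W' := arg_of _ w' in hchi.
pose G r := B r * B' r + u r * u' r - A r * A' r - W r * W' r.
have pE r th : 0 < r -> pairing xi chi (r * cos th) (r * sin th) =
    G r * (cos (k%:R * th) * sin (k%:R * th)).
  move=> r0; have [x1 x2 x3 x4] := hxi r th r0; have [y1 y2 y3 y4] := hchi r th r0.
  rewrite /pairing x1 x2 x3 x4 y1 y2 y3 y4 /G /=.
  have := cos2sin2 th; have := cos2sin2 (n%:R * th).
  move: (A r) (B r) (W r) (u r) (A' r) (B' r) (W' r) (u' r) (cos th) (sin th)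
    (cos (k%:R * th)) (sin (k%:R * th)) (cos (n%:R * th)) (sin (n%:R * th)).
  by move=> a b c d a' b' c' d' co si ck sk cn sn csn cs; ring: csn cs.
split=> [r r0|].
  rewrite -(integral_cos_sin (G r) k1).
  by apply: eq_integral => th _; rewrite pE.
apply: plane_integral_odd => x y /polar_coordinates[r [th [r0 -> ->]]].
by rewrite -mulrN -sinN -{1}(cosN th) !pE// mulrN cosN sinN !mulrN.
Qed.

Lemma lin_indep_xi_chi v u w xi chi : nonzero_triple v u w ->
  polar_form xi (xi_polar n k f v u w) ->
  polar_form chi (chi_polar n k f v u w) -> lin_indep xi chi.
Proof.
move=> [r r0 nz] /multipolar_mode hxi /multipolar_mode hchi c d H.
have rn0 : r != 0 by rewrite gt_eqF.
have E th : let ck := cos (k%:R * th) in let sk := sin (k%:R * th) in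
    [/\ (c * sk - d * ck) * v r = 0, (c * ck + d * sk) * u r = 0
      & (c * sk - d * ck) * w r = 0].
  move=> ck sk; have [] := H _ _ (@polar_neq0 _ r th r0).
  have [-> -> -> ->] := hxi r th r0; have [-> -> -> ->] := hchi r th r0.
  rewrite /= -/ck -/sk.
  have := cos2sin2 th; have := cos2sin2 (n%:R * th).
  have vE : v r = - (r / k%:R) * rad_of k%:R v r.
    by rewrite /rad_of; move: (k%:R : R) kn0 => K K0; field; rewrite rn0 K0.
  have wE : w r = - k%:R^-1 * arg_of k%:R w r.
    by rewrite /arg_of; move: (k%:R : R) kn0 => K K0; field; rewrite K0.
  rewrite vE wE; clearbody ck sk.
  move: (rad_of _ _ _) (ang_of _ _ _ _) (arg_of _ _ _) (cos th) (sin th)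
    (cos (n%:R * th)) (sin (n%:R * th)) (u r) => a b e co si cn sn z csn cs
    e1 e2 e3 e4.
  split.
  - transitivity (- (r / k%:R) * (co * 0 + si * 0)); last by ring.
    by rewrite -{1}e1 -e2; ring: cs.
  - transitivity (cn * 0 + sn * 0 : R); last by ring.
    by rewrite -{1}e3 -e4; ring: csn.
  - transitivity (- k%:R^-1 * (- sn * 0 + cn * 0)); last by ring.
    by rewrite -{1}e3 -e4; ring: csn.
have kp : k%:R * (pi / 2 / k%:R) = pi / 2 :> R by rewrite mulrCA divff ?mulr1.
have := E (pi / 2 / k%:R); rewrite /= kp sin_pihalf cos_pihalf => -[a1 a2 a3].
have := E 0; rewrite /= (mulr0 k%:R) sin0 cos0 => -[b1 b2 b3].
have zero (x y : R) : x != 0 -> y * x = 0 -> y = 0.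
  by move=> x0 /eqP; rewrite mulf_eq0 (negbTE x0) orbF => /eqP.
case/or3P: nz => x0; split; apply: (zero _ _ x0).
- by rewrite -a1; ring.
- by apply/eqP; rewrite -oppr_eq0 -b1; apply/eqP; ring.
- by rewrite -b2; ring.
- by rewrite -a2; ring.
- by rewrite -a3; ring.
- by apply/eqP; rewrite -oppr_eq0 -b3; apply/eqP; ring.
Qed.

Lemma xi_chi_degeneracy om2 v u w : smooth_pos v -> smooth_pos u -> smooth_pos w ->
  Hbar_eq n k lam f beta om2 v u w -> nonzero_triple v u w ->
  exists xi chi : field R,
    [/\ polar_form xi (xi_polar n k f v u w)
        /\ polar_form chi (chi_polar n k f v u w),
        background_gauge Psi xi /\ eigen_eq lam Psi om2 xi,
        background_gauge Psi chi /\ eigen_eq lam Psi om2 chi,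
        orthogonal_fields xi chi & lin_indep xi chi].
Proof.
move=> sv su sw hH nz.
have E (th th' : R) : cos th = cos th' -> sin th = sin th' ->
    [/\ cos (k%:R * th) = cos (k%:R * th'), sin (k%:R * th) = sin (k%:R * th'),
        cos (n%:R * th) = cos (n%:R * th') & sin (n%:R * th) = sin (n%:R * th')].
  by move=> c s; have [] := cos_sin_natmul_eq c s k; have [] := cos_sin_natmul_eq c s n.
have [xi hxi] : exists xi, polar_form xi (xi_polar n k f v u w).
  by apply: polar_field_exists => r th th' c s /=;
    have [e1 e2 e3 e4] := E _ _ c s; rewrite ?e1 ?e2 ?e3 ?e4 ?c ?s.
have [chi hchi] : exists chi, polar_form chi (chi_polar n k f v u w).
  by apply: polar_field_exists => r th th' c s /=;
    have [e1 e2 e3 e4] := E _ _ c s; rewrite ?e1 ?e2 ?e3 ?e4 ?c ?s.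
exists xi, chi; split => //.
- exact/(xi_equiv om2 sv su sw hxi).
- exact/(chi_equiv om2 sv su sw hchi).
- exact: orthogonal_xi_chi hxi hchi.
- exact: lin_indep_xi_chi nz hxi hchi.
Qed.

End MultipolarModes.

Lemma derrick_mode v u xi : polar_form xi (derrick_polar n v u) <->
  polar_form xi
    (mode_polar n (fun=> 1 : R) (fun=> 0) (fun=> 0) (fun r => -1 * v r) u (fun=> 0)).
Proof. by split; apply: polar_form_eq => r th r0 /=; split; ring. Qed.

(* The case [kk = 0] with constant angular factors [C = 1] and [S = 0]. *)
Lemma derrick_equiv om2 v u xi : smooth_pos v -> smooth_pos u ->
  polar_form xi (derrick_polar n v u) ->
  background_gauge Psi xi /\ eigen_eq lam Psi om2 xi <->
  Hbar0_eq n lam f beta om2 v u.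
Proof.
move=> sv su /derrick_mode hxi.
have s0 : smooth_pos (fun=> 0 : R) by apply/smooth_genP/gen_const.
have sB : smooth_pos (fun r => -1 * v r).
  by apply/smooth_genP/gen_mul; [exact: gen_const|exact: gen_smooth].
have wC : wave (0 : R) (fun=> 1) (fun=> - 0 * 0).
  by split=> th; apply: is_derive_eq (is_derive_const _ th) _; ring.
have wS : wave (0 : R) (fun=> 0) (fun=> 0 * 1).
  by split=> th; apply: is_derive_eq (is_derive_const _ th) _; ring.
have d1 (r : R) : 0 < r -> derive1 (fun r => -1 * v r) r = -1 * derive1 v r.
  by move=> r0; apply/is_derive_derive1/is_derive_scale/smooth_is_derive.
have d2 (r : R) : 0 < r ->
    derive1 (derive1 (fun r => -1 * v r)) r = -1 * derive1 (derive1 v) r.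
  move=> r0; rewrite (derive1_pos_eq r0 d1).
  exact/is_derive_derive1/is_derive_scale/(smooth_is_derive (smooth_derive1 sv)).
have res r : 0 < r ->
    (res_ang n f beta 0 om2 (fun=> 0) (fun r => -1 * v r) u r = 0 /\
     res_mod n lam f beta 0 om2 (fun r => -1 * v r) u (fun=> 0) r = 0) <->
    ((- derive1n 2 v r - r^-1 * derive1 v r + (1 / r ^+ 2 + f r ^+ 2) * v r
     + 2 * n%:R / r * (1 - beta r) * f r * u r = om2 * v r)
    /\
    (2 * n%:R / r * (1 - beta r) * f r * v r
     + (- derive1n 2 u r - r^-1 * derive1 u r
        + (n%:R ^+ 2 * (1 - beta r) ^+ 2 / r ^+ 2
           + 3 * lam / 2 * f r ^+ 2 - lam / 2) * u r) = om2 * u r)).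
  have eq0 (a b c : R) : c = a - b -> c = 0 <-> a = b.
    move=> ->; split=> [/eqP|->]; last exact: subrr.
    by rewrite subr_eq0 => /eqP.
  have eq0N (a b c : R) : c = - (a - b) -> c = 0 <-> a = b.
    move=> ->; split=> [/eqP|->]; last by rewrite subrr oppr0.
    by rewrite oppr_eq0 subr_eq0 => /eqP.
  move=> r0; rewrite /res_ang /res_mod d1// d2// /derive1n /=.
  have := gt_eqF r0.
  move: (derive1 (derive1 v) r) (derive1 v r) (v r) (derive1 (derive1 u) r)
    (derive1 u r) (u r) (f r) (beta r) => v2 v1 v0 u2 u1 u0 f0 b0 rn0.
  split=> -[h1 h2]; split.
  - by apply/(eq0N _ _ _ _).1: h1; field; rewrite rn0.
  - by apply/(eq0 _ _ _ _).1: h2; field; rewrite rn0.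
  - by apply/(eq0N _ _ _ _).2: h1; field; rewrite rn0.
  - by apply/(eq0 _ _ _ _).2: h2; field; rewrite rn0.
have eE := eigen_eq_mode lam sf hPsi wC wS s0 sB su s0 hxi om2.
have gE := background_gauge_mode lam sf hPsi wC wS s0 sB su s0 hxi.
split=> [[_ /eE H] r r0|H].
  have [_ h2 h3 _] := H r 0 r0.
  by apply/(res r r0); move: h2 h3; rewrite !mul1r.
split; first by apply/gE => r th r0; rewrite mul0r.
apply/eE => r th r0; have [h2 h3] := (res r r0).2 (H r r0).
by rewrite !mul0r h2 h3 !mulr0.
Qed.

Lemma derrick_characterization om2 xi :
  [/\ admissible0 n xi, background_gauge Psi xi & eigen_eq lam Psi om2 xi] <->
  exists v u : R -> R,
    [/\ smooth_pos v, smooth_pos u, polar_form xi (derrick_polar n v u)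
      & Hbar0_eq n lam f beta om2 v u].
Proof.
have sN (g : R -> R) : smooth_pos g -> smooth_pos (fun r => -1 * g r).
  by move=> sg; apply/smooth_genP/gen_mul; [exact: gen_const|exact: gen_smooth].
split=> [[[g [t [sg st h]]] hg he]|[v [u [sv su h hH]]]].
  have hxi : polar_form xi (derrick_polar n (fun r => -1 * g r) t).
    by apply: polar_form_eq h => r th r0 /=; split; ring.
  exists (fun r => -1 * g r), t; split; [exact: sN|exact: st|exact: hxi|].
  by apply/(derrick_equiv om2 (sN _ sg) st hxi).
have [hg he] := (derrick_equiv om2 sv su h).2 hH.
split=> //; exists (fun r => -1 * v r), u; split; [exact: sN|exact: su|].
by apply: polar_form_eq h => r th r0 /=; split; ring.
Qed.

End Vortex.

Theorem proposition6p3 (R : realType) (n : nat) (lam : R) (f beta : R -> R)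
    (Psi : field R) (hn : (1 <= n)%N) (hlam : 0 < lam) (hlam1 : lam != 1)
    (hprof : vortex_profiles n lam f beta)
    (hPsi : polar_form Psi (vortex_polar n f beta)) :
  (* Derrick-type modes *)
  [/\ (forall (om2 : R) (xi : field R),
        [/\ admissible0 n xi, background_gauge Psi xi & eigen_eq lam Psi om2 xi]
        <->
        (exists v u : R -> R,
          [/\ smooth_pos v, smooth_pos u,
              polar_form xi (derrick_polar n v u)
            & Hbar0_eq n lam f beta om2 v u])),
      (forall (om2 : R) (v u : R -> R) (xi : field R),
        smooth_pos v -> smooth_pos u ->
        polar_form xi (derrick_polar n v u) ->
        (background_gauge Psi xi /\ eigen_eq lam Psi om2 xi
         <-> Hbar0_eq n lam f beta om2 v u))
  (* multipolar modes *)
    & forall k : nat, (1 <= k)%N ->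
      [/\ (* first type *)
          (forall (om2 : R) (xi : field R),
            [/\ admissible n k xi, background_gauge Psi xi
              & eigen_eq lam Psi om2 xi]
            <->
            (exists v u w : R -> R,
              [/\ smooth_pos v, smooth_pos u, smooth_pos w,
                  polar_form xi (xi_polar n k f v u w)
                & Hbar_eq n k lam f beta om2 v u w])),
          (* second type *)
          (forall (om2 : R) (v u w : R -> R) (chi : field R),
            smooth_pos v -> smooth_pos u -> smooth_pos w ->
            polar_form chi (chi_polar n k f v u w) ->
            (background_gauge Psi chi /\ eigen_eq lam Psi om2 chi
             <-> Hbar_eq n k lam f beta om2 v u w)),
          (* orthogonality of the two types *)
          (forall (om2 : R) (v u w v' u' w' : R -> R) (xi chi : field R),
            smooth_pos v -> smooth_pos u -> smooth_pos w ->
            smooth_pos v' -> smooth_pos u' -> smooth_pos w' ->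
            Hbar_eq n k lam f beta om2 v u w ->
            Hbar_eq n k lam f beta om2 v' u' w' ->
            polar_form xi (xi_polar n k f v u w) ->
            polar_form chi (chi_polar n k f v' u' w') ->
            orthogonal_fields xi chi)
          (* double degeneracy *)
        & forall (om2 : R) (v u w : R -> R),
            smooth_pos v -> smooth_pos u -> smooth_pos w ->
            Hbar_eq n k lam f beta om2 v u w ->
            nonzero_triple v u w ->
            exists xi chi : field R,
              [/\ polar_form xi (xi_polar n k f v u w)
                  /\ polar_form chi (chi_polar n k f v u w),
                  background_gauge Psi xi /\ eigen_eq lam Psi om2 xi,
                  background_gauge Psi chi /\ eigen_eq lam Psi om2 chi,
                  orthogonal_fields xi chi
                & lin_indep xi chi]]].
Proof.
split.
- by move=> om2 xi; exact: derrick_characterization hprof hPsi om2 xi.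
- by move=> om2 v u xi sv su h; exact: (derrick_equiv hprof hPsi om2 sv su h).
move=> k k1; split.
- by move=> om2 xi; exact: (xi_characterization hprof hPsi k1 om2 xi).
- by move=> om2 v u w chi sv su sw h; exact: (chi_equiv hprof hPsi k1 om2 sv su sw h).
- move=> om2 v u w v' u' w' xi chi _ _ _ _ _ _ _ _.
  exact: orthogonal_xi_chi.
- move=> om2 v u w sv su sw; exact: (xi_chi_degeneracy hprof hPsi k1 sv su sw).
Qed.
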